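(* Work under the standing assumptions (A1)--(A4) of the context. Let $f$ and, for every $k\in\mathcal{L}$, $\ell(k;\cdot)$ be proper, convex and lower-semicontinuous, and let $\delta>0$. Then the sequence $\{(\alpha^t,\beta^t,\lambda^t,y^t)\}_{t\in\mathbb{N}}$ produced by the discrete-continuous ADMM algorithm (described in the context) converges to a ''discrete-continuous'' critical point $(\alpha^*,\beta^*,\lambda^*,y^* )$ of the discrete-continuous augmented Lagrangian $\mathfrak{L}_\rho$, i.e. a point with $0\in\partial(\ell(y_i^*;\cdot))(\beta_i^* )-\lambda_i^*$ for all $i\in\mathcal{V}$, $0\in\partial f(\alpha^* )+K^\top\lambda^*$, $K\alpha^*=\beta^*$, and $E_C(y^* )<\infty$ for all $C\in\mathcal{C}$. Moreover $\alpha^*$ solves to global optimality the problem $$\min_{\alpha\in\mathbb{R}^{|\mathcal{V}|\times|\mathcal{L}|}}\ \sum_{i\in\mathcal{V}}\ell(y_i^*;K_i\alpha)+f(\alpha).$$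
   Context: Setting. $(\mathcal{V},\mathcal{C})$ is a finite hypergraph ($\mathcal{C}$ is a set of subsets of $\mathcal{V}$), $\mathcal{L}$ is a finite label set, $\mathcal{Y}=\mathcal{L}^{|\mathcal{V}|}$ is the set of labelings. For each $C\in\mathcal{C}$, $E_C:\mathcal{Y}\to\mathbb{R}\cup\{+\infty\}$ is an energy (depending only on the labels of vertices in $C$). $\ell:\mathcal{L}\times\mathbb{R}^{|\mathcal{L}|}\to\mathbb{R}$ is a loss function. $\Phi(X)$ is a feature matrix with $|\mathcal{V}|$ columns (the features may be infinite-dimensional), $K=\Phi(X)^\top\Phi(X)\in\mathbb{R}^{|\mathcal{V}|\times|\mathcal{V}|}$ is the kernel matrix, $K_i$ its $i$-th row. $h:[0,\infty)\to\mathbb{R}$ is strictly monotonically increasing and $f:\mathbb{R}^{|\mathcal{V}|\times|\mathcal{L}|}\to\mathbb{R}$, $f(\alpha)=h(\|\Phi(X)\alpha\|_F)$. For a matrix, the subscript $i$ denotes the $i$-th row; $\langle\cdot,\cdot\rangle$ is the Frobenius inner product. For $\rho>0$, $\alpha,\beta,\lambda\in\mathbb{R}^{|\mathcal{V}|\times|\mathcal{L}|}$, $y\in\mathcal{Y}$, the discrete-continuous augmented Lagrangian is $$\mathfrak{L}_\rho(\alpha,\beta,\lambda,y)=\sum_{i\in\mathcal{V}}\ell(y_i;\beta_i)+f(\alpha)+\sum_{C\in\mathcal{C}}E_C(y)+\langle\lambda,K\alpha-\beta\rangle+\frac{\rho}{2}\|K\alpha-\beta\|_F^2.$$ Standing assumptions.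 (A1) $f$ is lower-bounded, $L$-smooth (differentiable with $L$-Lipschitz gradient) and $m$-semiconvex for some $m>0$ ($f+\frac m2\|\cdot\|_F^2$ is convex). (A2) For every $k\in\mathcal{L}$, $\ell(k;\cdot)$ is lower-bounded. (A3) $K$ is surjective, i.e. the smallest eigenvalue $\sigma_{\min}(K^\top K)$ of $K^\top K$ is positive. (A4) After finitely many iterations the penalty parameter is kept fixed at a value $\rho$ (i.e. there is $T_0\ge1$ with $\rho_t=\rho$ for all $t\ge T_0$) satisfying $$\frac{L^2}{\rho\,\sigma_{\min}(K^\top K)}+\frac{m-\rho\,\sigma_{\min}(K^\top K)}{2}<0.\qquad(\ast)$$ Algorithm (discrete-continuous ADMM) with parameter $\delta\ge0$. Initialize $\alpha^0,\lambda^0$, $\rho_0>0$, $\tau>1$, and $\rho_{\max}$ satisfying $(\ast)$; $y^0\in\mathcal{Y}$ denotes the starting labeling. At iteration $t$, with penalty $\rho_t$ (written $\rho$ in the following steps): 1. For each $i\in\mathcal{V}$, $k\in\mathcal{L}$ let $B^{t+1}_{i,k}\in\mathbb{R}^{|\mathcal{L}|}$ be a minimizer, and $u^{t+1}_{i,k}$ the minimum value, over $b\in\mathbb{R}^{|\mathcal{L}|}$ of $\ell(k;b)+\frac{\rho}{2}\|b-K_i\alpha^t-\lambda_i^t/\rho\|^2$. For $y\in\mathcal{Y}$ let $B^{t+1}_{:,y}$ be the matrix with $i$-th row $B^{t+1}_{i,y_i}$. 2. Choose a candidate $\hat y\in\mathcal{Y}$ as a (possibly suboptimal) solution of $\min_{y\in\mathcal{Y}}\sum_i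 u^{t+1}_{i,y_i}+\sum_C E_C(y)$. If $\mathfrak{L}_\rho(\alpha^t,B^{t+1}_{:,\hat y},\lambda^t,\hat y)-\mathfrak{L}_\rho(\alpha^t,B^{t+1}_{:,y^t},\lambda^t,y^t)\le-\delta$, set $y^{t+1}=\hat y$; otherwise set $y^{t+1}=y^t$. 3. $\beta^{t+1}=B^{t+1}_{:,y^{t+1}}$. 4. $\alpha^{t+1}\in\arg\min_\alpha\mathfrak{L}_\rho(\alpha,\beta^{t+1},\lambda^t,y^{t+1})$. 5. $\lambda^{t+1}=\lambda^t+\rho(K\alpha^{t+1}-\beta^{t+1})$. 6. If $\rho_t$ violates $(\ast)$, set $\rho_{t+1}=\min\{\rho_{\max},\tau\rho_t\}$; otherwise $\rho_{t+1}=\rho_t$. $\partial$ denotes the limiting (Mordukhovich) subdifferential in the sense of Rockafellar--Wets, Variational Analysis, Definition 8.3 (which is the usual convex subdifferential for convex functions).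
   Formalization: The formal statement additionally assumes that the starting labeling y^0 or at least one candidate labeling has finite energy E_C for all C; otherwise (e.g. some E_C identically +∞) the claim E_C(y* )<∞ is false. *)

(* Defs.v *)
From HB Require Import structures.
From mathcomp Require Export all_boot all_order all_algebra.
From mathcomp Require Export sesquilinear.
From mathcomp Require Export all_classical all_reals all_analysis.
Export Order.TTheory GRing.Theory Num.Theory.
Export numFieldNormedType.Exports.

Set Implicit Arguments.
Unset Strict Implicit.
Unset Printing Implicit Defensive.

Local Open Scope classical_set_scope.
Local Open Scope ring_scope.

(* The norm that the library puts on matrices is the max norm; it induces the
   same topology as the Frobenius norm, so library limits and differentials are
   used as they are, but every quantitative notion goes through [frob]. *)
Definition frob_dot (R : realType) (p q : nat) (A B : 'M[R]_(p, q)) : R :=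
  \sum_i \sum_j A i j * B i j.

Definition frob (R : realType) (p q : nat) (A : 'M[R]_(p, q)) : R :=
  Num.sqrt (frob_dot A A).

(* Representer of the differential for [frob_dot]. *)
Definition gradient (R : realType) (p q : nat) (g : 'M[R]_(p, q) -> R)
    (x : 'M[R]_(p, q)) : 'M[R]_(p, q) :=
  \matrix_(i, j) 'd g x (delta_mx i j).

Definition smooth (R : realType) (p q : nat) (L : R) (g : 'M[R]_(p, q) -> R) :=
  (forall x, differentiable g x) /\
  (forall x z, frob (gradient g x - gradient g z) <= L * frob (x - z)).

Definition convex (R : realType) (p q : nat) (g : 'M[R]_(p, q) -> R) :=
  convex_function setT g.

Definition semiconvex (R : realType) (p q : nat) (m : R)
    (g : 'M[R]_(p, q) -> R) :=
  convex (fun x => g x + m / 2 * frob x ^+ 2).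

Definition lower_bounded (R : realType) (T : Type) (g : T -> R) :=
  has_lbound (range g).

Definition proper (R : realType) (T : Type) (g : T -> \bar R) :=
  (forall x, (-oo < g x)%E) /\ (exists x, (g x < +oo)%E).

Definition proper_convex_lsc (R : realType) (p q : nat)
    (g : 'M[R]_(p, q) -> R) :=
  [/\ proper (EFin \o g), convex g & lower_semicontinuous (EFin \o g)].

(* Regular and limiting (Mordukhovich) subgradients of Rockafellar-Wets,
   Definition 8.3, for functions that are finite everywhere. The o(|z - x|)
   term of the regular subgradient inequality is written with epsilons. *)
Definition regular_subdiff (R : realType) (p q : nat) (g : 'M[R]_(p, q) -> R)
    (x : 'M[R]_(p, q)) : set 'M[R]_(p, q) :=
  [set v | forall e : R, 0 < e -> \forall z \near x,
     g x + frob_dot v (z - x) - e * frob (z - x) <= g z].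

Definition subdiff (R : realType) (p q : nat) (g : 'M[R]_(p, q) -> R)
    (x : 'M[R]_(p, q)) : set 'M[R]_(p, q) :=
  [set v | exists xs vs : nat -> 'M[R]_(p, q),
     [/\ xs @ \oo --> x, (g \o xs) @ \oo --> g x,
         forall k, regular_subdiff g (xs k) (vs k) & vs @ \oo --> v]].

(* Smallest eigenvalue of a symmetric real matrix. For n = 0 the set is empty
   and the value is 0, so positivity of [sigma_min] forces n > 0. *)
Definition sigma_min (R : realType) (n : nat) (A : 'M[R]_n) : R :=
  inf [set a | eigenvalue A a].

(* Vertices are 'I_n and labels 'I_q, so that R^(|V| x |L|) is 'M[R]_(n, q).
   [phi i] is the i-th column of the feature matrix; the columns live in an
   arbitrary real inner product space, possibly infinite-dimensional. *)
Record dc_model (R : realType) (n q : nat) := DCModel {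
  edges : {set {set 'I_n}};
  energy : {set 'I_n} -> {ffun 'I_n -> 'I_q} -> \bar R;
  energy_gtNy : forall C y, C \in edges -> (-oo < energy C y)%E;
  energy_local : forall C (y y' : {ffun 'I_n -> 'I_q}), C \in edges ->
    {in C, y =1 y'} -> energy C y = energy C y';
  loss : 'I_q -> 'rV[R]_q -> R;
  feature_space : lmodType R;
  feature_dot : {dot feature_space for idfun};
  phi : 'I_n -> feature_space;
  h : R -> R;
  h_incr : {in `[0, +oo[ &, {homo h : s t / s < t}} }.

Definition kernel (R : realType) (n q : nat) (M : dc_model R n q) : 'M[R]_n :=
  \matrix_(i, j) feature_dot M (phi M i) (phi M j).

(* j-th column of the product of the feature matrix with [alpha]. *)
Definition feature_comb (R : realType) (n q : nat) (M : dc_model R n q)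
    (alpha : 'M[R]_(n, q)) (j : 'I_q) : feature_space M :=
  \sum_i alpha i j *: phi M i.

Definition regularizer (R : realType) (n q : nat) (M : dc_model R n q)
    (alpha : 'M[R]_(n, q)) : R :=
  h M (Num.sqrt (\sum_j
    feature_dot M (feature_comb M alpha j) (feature_comb M alpha j))).

Definition feasible (R : realType) (n q : nat) (M : dc_model R n q)
    (y : {ffun 'I_n -> 'I_q}) :=
  forall C, C \in edges M -> (energy M C y < +oo)%E.

Definition lagrangian (R : realType) (n q : nat) (M : dc_model R n q) (rho : R)
    (alpha beta lam : 'M[R]_(n, q)) (y : {ffun 'I_n -> 'I_q}) : \bar R :=
  ((\sum_i loss M (y i) (row i beta) + regularizer M alpha)%:E
   + \sum_(C in edges M) energy M C y
   + (frob_dot lam (kernel M *m alpha - beta)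
      + rho / 2 * frob (kernel M *m alpha - beta) ^+ 2)%R%:E)%E.

Definition sigma (R : realType) (n q : nat) (M : dc_model R n q) : R :=
  sigma_min ((kernel M)^T *m kernel M).

Definition penalty_ok (R : realType) (n q : nat) (M : dc_model R n q)
    (L m rho : R) : bool :=
  L ^+ 2 / (rho * sigma M) + (m - rho * sigma M) / 2 < 0.

Definition unary_objective (R : realType) (n q : nat) (M : dc_model R n q)
    (rho : R) (alpha lam : 'M[R]_(n, q)) (i : 'I_n) (k : 'I_q)
    (b : 'rV[R]_q) : R :=
  loss M k b
  + rho / 2 * frob (b - row i (kernel M) *m alpha - rho^-1 *: row i lam) ^+ 2.

Definition select_rows (R : realType) (n q : nat)
    (B : 'I_n -> 'I_q -> 'rV[R]_q) (y : {ffun 'I_n -> 'I_q}) : 'M[R]_(n, q) :=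
  \matrix_(i < n) B i (y i).

(* [dc_admm] says that the sequences form a run of the algorithm. The values of
   [beta], [B], [u] and [yhat] at index 0 are unused. The candidates [yhat] are
   unconstrained because suboptimal ones are allowed, so the values [u] do not
   influence the run. Pitfalls of the extended reals: if both labelings compared
   in [dc_label] are infeasible, the difference is +oo - +oo, which is -oo, and
   the candidate is accepted; if [y t.+1] is infeasible, the Lagrangian is
   constantly +oo and [dc_alpha] does not constrain [alpha t.+1]. *)
Record dc_admm (R : realType) (n q : nat) (M : dc_model R n q)
    (L m delta tau rho_max : R)
    (alpha beta lam : nat -> 'M[R]_(n, q))
    (y yhat : nat -> {ffun 'I_n -> 'I_q})
    (B : nat -> 'I_n -> 'I_q -> 'rV[R]_q)
    (u : nat -> 'I_n -> 'I_q -> R) (rho_ : nat -> R) : Prop := DCADMM {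
  dc_rho0 : 0 < rho_ 0%N;
  dc_tau : 1 < tau;
  dc_rho_max : 0 < rho_max /\ penalty_ok M L m rho_max;
  dc_unary : forall t i k,
    (forall b, unary_objective M (rho_ t) (alpha t) (lam t) i k (B t.+1 i k)
               <= unary_objective M (rho_ t) (alpha t) (lam t) i k b) /\
    u t.+1 i k
      = unary_objective M (rho_ t) (alpha t) (lam t) i k (B t.+1 i k);
  dc_label : forall t,
    y t.+1 =
      if (lagrangian M (rho_ t) (alpha t) (select_rows (B t.+1) (yhat t.+1))
            (lam t) (yhat t.+1)
          - lagrangian M (rho_ t) (alpha t) (select_rows (B t.+1) (y t))
            (lam t) (y t) <= (- delta)%:E)%E
      then yhat t.+1 else y t;
  dc_beta : forall t, beta t.+1 = select_rows (B t.+1) (y t.+1);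
  dc_alpha : forall t a,
    (lagrangian M (rho_ t) (alpha t.+1) (beta t.+1) (lam t) (y t.+1)
     <= lagrangian M (rho_ t) a (beta t.+1) (lam t) (y t.+1))%E;
  dc_lam : forall t,
    lam t.+1 = lam t + rho_ t *: (kernel M *m alpha t.+1 - beta t.+1);
  dc_rho : forall t,
    rho_ t.+1 = if penalty_ok M L m (rho_ t) then rho_ t
                else Num.min rho_max (tau * rho_ t) }.

Definition dc_critical (R : realType) (n q : nat) (M : dc_model R n q)
    (alpha beta lam : 'M[R]_(n, q)) (y : {ffun 'I_n -> 'I_q}) :=
  [/\ forall i,
        [set v - row i lam | v in subdiff (loss M (y i)) (row i beta)] 0,
      [set v + (kernel M)^T *m lam | v in subdiff (regularizer M) alpha] 0,
      kernel M *m alpha = beta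
    & feasible M y].

(* Main.v *)
Require Import Defs.
From mathcomp Require Import ring lra.

Set Implicit Arguments.
Unset Strict Implicit.
Unset Printing Implicit Defensive.

Local Open Scope classical_set_scope.
Local Open Scope ring_scope.

(** Once a finite-energy labeling has been seen, all later labelings are
    feasible. With the penalty fixed, the alpha-step gives
    [K lam^t = - grad f (alpha^t)], so the increase of the Lagrangian in the
    lam-step is at most [L^2 / (rho sigma) |alpha^(t+1) - alpha^t|^2] and is
    outweighed by the strong convexity of the alpha-step; each change of label
    costs at least [delta]. The Lagrangian is bounded below, so the labels
    stabilize and [alpha^(t+1) - alpha^t] tends to 0. Since [f] is a convex
    increasing function of the norm of [Phi alpha], it is coercive, which makes
    [alpha^t] bounded; a cluster point [a], with the multiplier
    [l = - K^-1 grad f (a)], is a saddle point for the final labeling. Around it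
    [|lam^t - l|^2 / rho + rho |K (alpha^t - a)|^2] is nonincreasing, and it
    vanishes along a subsequence, hence tends to 0. *)

(** * Frobenius inner product and limits of matrices *)

Section frob_dot_theory.
Context {R : realType} {p q : nat}.
Implicit Types (A B C : 'M[R]_(p, q)) (c : R).

Lemma frob_dotC A B : frob_dot A B = frob_dot B A.
Proof. by do 2!apply: eq_bigr => ? _; rewrite mulrC. Qed.

Lemma frob_dotDl A B C : frob_dot (A + B) C = frob_dot A C + frob_dot B C.
Proof.
rewrite -big_split; apply: eq_bigr => i _ /=; rewrite -big_split.
by apply: eq_bigr => j _ /=; rewrite !mxE mulrDl.
Qed.

Lemma frob_dotZl c A B : frob_dot (c *: A) B = c * frob_dot A B.
Proof.
rewrite /frob_dot mulr_sumr; apply: eq_bigr => i _; rewrite mulr_sumr.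
by apply: eq_bigr => j _; rewrite !mxE mulrA.
Qed.

Lemma frob_dotNl A B : frob_dot (- A) B = - frob_dot A B.
Proof. by rewrite -scaleN1r frob_dotZl mulN1r. Qed.

Lemma frob_dotDr A B C : frob_dot A (B + C) = frob_dot A B + frob_dot A C.
Proof. by rewrite frob_dotC frob_dotDl !(frob_dotC A). Qed.

Lemma frob_dotZr c A B : frob_dot A (c *: B) = c * frob_dot A B.
Proof. by rewrite frob_dotC frob_dotZl frob_dotC. Qed.

Lemma frob_dotNr A B : frob_dot A (- B) = - frob_dot A B.
Proof. by rewrite frob_dotC frob_dotNl frob_dotC. Qed.

Definition frob_dot_linE := (frob_dotDl, frob_dotDr, frob_dotNl, frob_dotNr,
  frob_dotZl, frob_dotZr).

Lemma frob_dot0l A : frob_dot 0 A = 0.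
Proof. by rewrite -(scale0r (0 : 'M[R]_(p, q))) frob_dotZl mul0r. Qed.

Lemma frob_dot0r A : frob_dot A 0 = 0.
Proof. by rewrite frob_dotC frob_dot0l. Qed.

Lemma frob_dot_ge0 A : 0 <= frob_dot A A.
Proof. by do 2!apply: sumr_ge0 => ? _; rewrite -expr2 sqr_ge0. Qed.

Lemma sqr_frob A : frob A ^+ 2 = frob_dot A A.
Proof. by rewrite sqr_sqrtr// frob_dot_ge0. Qed.

Lemma frob_ge0 A : 0 <= frob A. Proof. exact: sqrtr_ge0. Qed.

Lemma sqr_entry_le A i j : A i j ^+ 2 <= frob_dot A A.
Proof.
rewrite /frob_dot (bigD1 i)//= (bigD1 j)//= -expr2 -addrA lerDl addr_ge0//.
  by apply: sumr_ge0 => k _; rewrite -expr2 sqr_ge0.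
by do 2!apply: sumr_ge0 => ? _; rewrite -expr2 sqr_ge0.
Qed.

Lemma frob_dot_eq0 A : frob_dot A A = 0 -> A = 0.
Proof.
move=> A0; apply/matrixP => i j; rewrite mxE; apply/eqP.
by rewrite -sqrf_eq0 eq_le sqr_ge0 andbT -A0 sqr_entry_le.
Qed.

Lemma frob_dot_rows A B : frob_dot A B = \sum_i frob_dot (row i A) (row i B).
Proof.
apply: eq_bigr => i _; rewrite /frob_dot big_ord1.
by apply: eq_bigr => j _; rewrite !mxE.
Qed.

Lemma frob_dotD_le A B :
  frob_dot (A + B) (A + B) <= 2 * frob_dot A A + 2 * frob_dot B B.
Proof.
have := frob_dot_ge0 (A - B).
by rewrite !frob_dot_linE (frob_dotC B A) => h; lra.
Qed.

Lemma frob_dot_CS A B : frob_dot A B ^+ 2 <= frob_dot A A * frob_dot B B.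
Proof.
have [B0|B0] := eqVneq (frob_dot B B) 0.
  by rewrite (frob_dot_eq0 B0) !frob_dot0r mulr0 expr0n.
have Bp : 0 < frob_dot B B by rewrite lt_neqAle eq_sym B0 frob_dot_ge0.
(* The residual of projecting [A] on [B], scaled by [<B, B>] to avoid a division. *)
have := frob_dot_ge0 (frob_dot B B *: A - frob_dot A B *: B).
rewrite !frob_dot_linE (frob_dotC B A) => h.
by rewrite -subr_ge0 -(pmulr_rge0 _ Bp); apply: le_trans h _; rewrite le_eqVlt;
  apply/orP; left; apply/eqP; ring.
Qed.

Lemma frob_dot_le_frob A B : frob_dot A B <= frob A * frob B.
Proof.
rewrite -sqrtrM ?frob_dot_ge0//; apply: le_trans (ler_norm _) _.
by rewrite -sqrtr_sqr ler_wsqrtr// frob_dot_CS.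
Qed.

(** With [norm_frob_dot_le], compares the Frobenius norm to the max norm, so that limits may be
    computed in either. *)
Lemma frob_dot_norm_le A : frob_dot A A <= (p * q)%:R * `|A| ^+ 2.
Proof.
have le_entry i j : `|A i j| <= `|A|.
  rewrite [leRHS]/Num.norm/= mx_normrE.
  exact: (le_bigmax _ (fun ij : 'I_p * 'I_q => `|A ij.1 ij.2|) (i, j)).
rewrite /frob_dot; apply: (@le_trans _ _ (\sum_(i < p) \sum_(j < q) `|A| ^+ 2)).
  do 2!apply: ler_sum => ? _; rewrite -expr2 -real_normK ?num_real//.
  by rewrite ler_sqr ?nnegrE.
by rewrite sumr_const card_ord sumr_const card_ord -mulrnA mulnC mulr_natl.
Qed.

Lemma norm_frob_dot_le A : `|A| ^+ 2 <= frob_dot A A.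
Proof.
have [->|/mx_norm_neq0[[i j]/= Aij]] := eqVneq `|A| 0.
  by rewrite expr0n frob_dot_ge0.
have -> : `|A| = `|A i j| by [].
by rewrite real_normK ?num_real// sqr_entry_le.
Qed.

End frob_dot_theory.

Lemma frob_dot_mulmx (R : realType) (n q : nat) (K : 'M[R]_n)
    (A B : 'M[R]_(n, q)) :
  frob_dot A (K *m B) = frob_dot (K^T *m A) B.
Proof.
rewrite /frob_dot.
under eq_bigr do under eq_bigr do rewrite mxE mulr_sumr.
under [in RHS]eq_bigr do under eq_bigr do rewrite mxE mulr_suml.
under eq_bigr do rewrite exchange_big.
under [in RHS]eq_bigr do rewrite exchange_big.
rewrite exchange_big; apply: eq_bigr => i _; apply: eq_bigr => k _.
by apply: eq_bigr => j _; rewrite !mxE; ring.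
Qed.

(** Reduces matrix limits to scalar squeeze arguments on squared distances. *)
Lemma cvg_frob_dotP (R : realType) (p q : nat) (T : Type) (F : set_system T)
    {FF : Filter F} (A : T -> 'M[R]_(p, q)) (a : 'M[R]_(p, q)) :
  A @ F --> a <-> (fun t => frob_dot (A t - a) (A t - a)) @ F --> (0 : R).
Proof.
split=> [Aa|h].
  have Aa0 : (fun t => `|A t - a| : R) @ F --> (0 : R).
    by apply/norm_cvg0P; rewrite -(subrr a); apply: cvgB => //; exact: cvg_cst.
  apply: (@squeeze_cvgr _ _ _ _ (fun=> 0) (fun t => (p * q)%:R * `|A t - a| ^+ 2)).
  - by apply: nearW => t; rewrite frob_dot_ge0 frob_dot_norm_le.
  - exact: cvg_cst.
  - rewrite -(mulr0 (p * q)%:R); apply: cvgM; first exact: cvg_cst.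
    rewrite -[in X in _ --> X](mulr0 (0 : R)).
    by under eq_fun do rewrite expr2; apply: cvgM.
apply: cvg_zero; apply/norm_cvg0P => /=.
have -> : (fun t => `|A t - a|) = (fun t => Num.sqrt (`|A t - a| ^+ 2)).
  by apply/funext => t; rewrite sqrtr_sqr normr_id.
rewrite -[X in _ --> X](sqrtr0 R).
apply: (@continuous_cvg _ _ _ F FF _ Num.sqrt); first exact: sqrt_continuous.
apply: (@squeeze_cvgr _ _ _ _ (fun=> 0) (fun t => frob_dot (A t - a) (A t - a))) => //.
  by apply: nearW => t; rewrite sqr_ge0 norm_frob_dot_le.
exact: cvg_cst.
Qed.

Lemma cvg_frob_dot (R : realType) (p q : nat) (T : Type) (F : set_system T)
    {FF : Filter F} (A B : T -> 'M[R]_(p, q)) (a b : 'M[R]_(p, q)) :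
  A @ F --> a -> B @ F --> b ->
  (fun t => frob_dot (A t) (B t)) @ F --> frob_dot a b.
Proof.
move=> Aa Bb; have entry (C : T -> 'M[R]_(p, q)) (c : 'M[R]_(p, q)) i j :
    C @ F --> c -> (fun t => C t i j) @ F --> c i j.
  move=> Cc; apply: (@continuous_cvg _ _ _ F FF _ (fun M : 'M[R]_(p, q) => M i j) c _ Cc).
  exact: coord_continuous.
rewrite /frob_dot; apply: cvg_big => [|i _]; first exact: add_continuous.
apply: cvg_big => [|j _]; first exact: add_continuous.
by apply: cvgM; apply: entry.
Qed.

Lemma cvg_row (R : realType) (n q : nat) (T : Type) (F : set_system T) {FF : Filter F}
    (A : T -> 'M[R]_(n, q)) (a : 'M[R]_(n, q)) i :
  A @ F --> a -> (fun t => row i (A t)) @ F --> row i a.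
Proof.
move=> /cvg_frob_dotP Aa; apply/cvg_frob_dotP.
apply: (@squeeze_cvgr _ _ _ _ (fun=> 0) (fun t => frob_dot (A t - a) (A t - a))) => //.
  apply: nearW => t; rewrite frob_dot_ge0/= -linearB/= [leRHS]frob_dot_rows.
  by rewrite (bigD1 i)//= lerDl sumr_ge0// => j _; exact: frob_dot_ge0.
exact: cvg_cst.
Qed.

(** Divide by [s] and let [s] tend to 0: the shape in which first-order optimality arises below. *)
Lemma linear_coef_ge0 (R : realFieldType) (a c d : R) : 0 < d ->
  (forall s, 0 < s < d -> 0 <= s * a + s ^+ 2 * c) -> 0 <= a.
Proof.
move=> d0 h; rewrite leNgt; apply/negP => a0.
have Dp : 0 < 2 * (d * (`|c| + 1) - a).
  have : 0 <= d * (`|c| + 1) by rewrite mulr_ge0 ?ltW// ltr_wpDl.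
  by lra.
(* If [a < 0], this [s] is below [d / 2] and makes [s * |c| < - a / 2], so [a + s * c] stays
   negative. *)
pose s := d * - a / (2 * (d * (`|c| + 1) - a)).
have s0 : 0 < s by rewrite divr_gt0// mulr_gt0// oppr_gt0.
have sd : s < d.
  rewrite ltr_pdivrMr// ltr_pM2l//.
  have : 0 <= d * (`|c| + 1) by rewrite mulr_ge0 ?ltW// ltr_wpDl.
  by lra.
have sE : s * (2 * (d * (`|c| + 1) - a)) = d * - a.
  by rewrite mulfVK// gt_eqF.
have /h : 0 < s < d by rewrite s0.
have -> : s * a + s ^+ 2 * c = s * (a + s * c) by ring.
rewrite pmulr_rge0// => {}h.
have sc : s * c <= s * `|c| by rewrite ler_pM2l// ler_norm.
have : 0 <= s * - a by rewrite mulr_ge0// ?ltW// oppr_gt0.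
have : 0 <= d * s by rewrite mulr_ge0// ltW.
have : d * (a + s * `|c|) >= 0 by rewrite mulr_ge0//; lra.
have : d * a < 0 by rewrite pmulr_rlt0.
by nra.
Qed.

(** Bolzano-Weierstrass: the flattened matrices stay in a compact box. The bound [k <= s k] is all
    that is needed to send [s] to infinity. *)
Lemma bounded_matrix_subseq (R : realType) (p q : nat) (a : nat -> 'M[R]_(p, q))
    (C : R) : (forall t, frob_dot (a t) (a t) <= C) ->
  exists (s : nat -> nat) (l : 'M[R]_(p, q)),
    (forall k, (k <= s k)%N) /\ (a \o s) @ \oo --> l.
Proof.
move=> aC.
have C0 : 0 <= C by apply: le_trans (aC 0%N); exact: frob_dot_ge0.
pose A := [set v : 'rV[R]_(p * q) |
  forall i, `[- Num.sqrt C, Num.sqrt C]%classic (v ord0 i)].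
have cA : compact A.
  apply: (@rV_compact R _ (fun=> `[- Num.sqrt C, Num.sqrt C]%classic)) => _.
  exact: segment_compact.
have [|v [_ clv]] := cA ((fun t => mxvec (a t)) @ \oo) _.
  exists 0%N => // t _ i /=; rewrite in_itv/= -ler_norml.
  case/mxvec_indexP: i => i j; rewrite mxvecE -sqrtr_sqr ler_wsqrtr//.
  exact: le_trans (sqr_entry_le _ _ _) (aC t).
move: clv; rewrite -(vec_mxK v); move: (vec_mx v) => {v} l clv.
have /choice[s sP] : forall k, exists t,
    (k <= t)%N /\ `|mxvec l - mxvec (a t)| < k.+1%:R^-1.
  move=> k; have := clv [set x | exists2 t, (k <= t)%N & x = mxvec (a t)]
    (ball (mxvec l) k.+1%:R^-1).
  case=> [||x [[t kt ->]]].
  - by exists k => // t /= kt; exists t.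
  - by apply: nbhsx_ballx; rewrite invr_gt0.
  by rewrite -ball_normE /= => h; exists t.
exists s, l; split=> [k|]; first by have [] := sP k.
have cv : mxvec \o a \o s @ \oo --> mxvec l.
  apply/cvgrPdist_lt => e e0; near=> k.
  have [_ /lt_trans->//] := sP k.
  by near: k; exact: near_infty_natSinv_lt (PosNum e0).
apply/cvg_frob_dotP.
apply: (@squeeze_cvgr _ _ _ _ (fun=> 0)
  (fun k => frob_dot (mxvec (a (s k)) - mxvec l) (mxvec (a (s k)) - mxvec l))).
- apply: nearW => k; rewrite frob_dot_ge0/=.
  rewrite -raddfB.
  rewrite [leRHS]/frob_dot big_ord1 (reindex _ (curry_mxvec_bij _ _))/=.
  rewrite /frob_dot pair_bigA le_eqVlt; apply/orP; left; apply/eqP.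
  by apply: eq_bigr => -[i j] _ /=; rewrite !mxvecE.
- exact: cvg_cst.
- exact/cvg_frob_dotP.
Unshelve. all: by end_near. Qed.

Lemma frob_dot_tr (R : realType) (p q : nat) (A B : 'M[R]_(p, q)) :
  frob_dot A^T B^T = frob_dot A B.
Proof.
rewrite /frob_dot exchange_big; apply: eq_bigr => i _; apply: eq_bigr => j _.
by rewrite !mxE.
Qed.

Lemma frob_dot_mulmxr (R : realType) (n q : nat) (K : 'M[R]_n)
    (A B : 'M[R]_(q, n)) :
  frob_dot A (B *m K) = frob_dot (A *m K^T) B.
Proof.
by rewrite -frob_dot_tr trmx_mul frob_dot_mulmx trmxK -frob_dot_tr trmx_mul !trmxK.
Qed.

Lemma continuous_frob_dot (R : realType) (p q : nat) :
  continuous (fun A : 'M[R]_(p, q) => frob_dot A A).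
Proof.
by move=> A; apply: (@cvg_frob_dot _ _ _ _ (nbhs A) _ id id A A); exact: cvg_id.
Qed.

Lemma frob_dot_mul_le (R : realType) (m n p : nat) (A : 'M[R]_(m, n))
    (B : 'M[R]_(n, p)) :
  frob_dot (A *m B) (A *m B) <= frob_dot A A * frob_dot B B.
Proof.
rewrite {1 2}/frob_dot mulr_suml; apply: ler_sum => i _.
rewrite -(frob_dot_tr B) frob_dot_rows mulr_sumr; apply: ler_sum => j _.
have -> : (A *m B) i j = frob_dot (row i A) (row j B^T).
  by rewrite /frob_dot big_ord1 mxE; apply: eq_bigr => k _; rewrite !mxE.
rewrite -expr2 (le_trans (frob_dot_CS _ _))//.
rewrite le_eqVlt; apply/orP; left; apply/eqP; congr (_ * _).
by rewrite /frob_dot big_ord1; apply: eq_bigr => k _; rewrite !mxE.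
Qed.

Lemma cvg_mulmx (R : realType) (m n p : nat) (T : Type) (F : set_system T)
    {FF : Filter F} (A : 'M[R]_(m, n)) (B : T -> 'M[R]_(n, p)) (b : 'M[R]_(n, p)) :
  B @ F --> b -> (fun t => A *m B t) @ F --> A *m b.
Proof.
move=> /cvg_frob_dotP Bb; apply/cvg_frob_dotP.
apply: (@squeeze_cvgr _ _ _ _ (fun=> 0)
   (fun t => frob_dot A A * frob_dot (B t - b) (B t - b))).
- by apply: nearW => t; rewrite frob_dot_ge0/= -mulmxBr frob_dot_mul_le.
- exact: cvg_cst.
- by rewrite -[X in _ --> X](mulr0 (frob_dot A A)); apply: cvgM => //; exact: cvg_cst.
Qed.

Lemma cvg_mulmxr (R : realType) (m n p : nat) (T : Type) (F : set_system T)
    {FF : Filter F} (B : 'M[R]_(n, p)) (A : T -> 'M[R]_(m, n)) (a : 'M[R]_(m, n)) :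
  A @ F --> a -> (fun t => A t *m B) @ F --> a *m B.
Proof.
move=> /cvg_frob_dotP Aa; apply/cvg_frob_dotP.
apply: (@squeeze_cvgr _ _ _ _ (fun=> 0)
   (fun t => frob_dot (A t - a) (A t - a) * frob_dot B B)).
- by apply: nearW => t; rewrite frob_dot_ge0/= -mulmxBl frob_dot_mul_le.
- exact: cvg_cst.
- by rewrite -[X in _ --> X](mul0r (frob_dot B B)); apply: cvgM => //; exact: cvg_cst.
Qed.

(** Rayleigh quotient: [|v K^T|^2] attains its minimum on the unit sphere, a minimizer is an
    eigenvector, and the minimum is thus an eigenvalue, hence at least the infimum. A matrix [X]
    splits into its columns, transposed to row vectors. *)
Lemma sigma_min_gram_le (R : realType) (n q : nat) (K : 'M[R]_n)
    (X : 'M[R]_(n, q)) :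
  sigma_min (K^T *m K) * frob_dot X X <= frob_dot (K *m X) (K *m X).
Proof.
suff rowP (v : 'rV[R]_n) :
    sigma_min (K^T *m K) * frob_dot v v <= frob_dot (v *m K^T) (v *m K^T).
  rewrite -(frob_dot_tr X) -(frob_dot_tr (K *m X)) trmx_mul.
  rewrite !(@frob_dot_rows _ _ _ _ _) mulr_sumr; apply: ler_sum => i _.
  by rewrite row_mul rowP.
have [n0|n_gt0] := posnP n.
  by subst n; rewrite [frob_dot v v]big_ord1 big_ord0 mulr0 frob_dot_ge0.
pose S := [set v : 'rV[R]_n | frob_dot v v = 1].
have scale_unit (w : 'rV[R]_n) : frob_dot w w != 0 ->
    S ((Num.sqrt (frob_dot w w))^-1 *: w).
  move=> w0; rewrite /S/= frob_dotZl frob_dotZr mulrA -invfM -expr2.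
  by rewrite sqr_sqrtr ?frob_dot_ge0// mulVf.
have cS : compact S.
  apply: bounded_closed_compact.
    exists 1; split; first exact: num_real.
    move=> x x1 z Sz; apply: le_trans (ltW x1).
    rewrite -(@ler_pXn2r _ 2) ?nnegrE// expr1n.
    by apply: le_trans (norm_frob_dot_le z) _; rewrite Sz.
  have -> : S = (fun v : 'rV[R]_n => frob_dot v v) @^-1` [set 1] by [].
  apply: closed_comp; last exact: closed_eq.
  by move=> x _; exact: continuous_frob_dot.
pose Q := fun v : 'rV[R]_n => frob_dot (v *m K^T) (v *m K^T).
have cQ : continuous Q.
  move=> x; have cK := @cvg_mulmxr _ _ _ _ _ (nbhs x) (nbhs_filter x) K^T id x
    (@cvg_id _ (nbhs x)).
  exact: (cvg_frob_dot cK cK).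
have [|u uS umin] := compact_EVT_min _ cS (continuous_subspaceT cQ).
  exists (delta_mx 0 (Ordinal n_gt0)); rewrite /S/= /frob_dot big_ord1.
  rewrite (bigD1 (Ordinal n_gt0))//= big1 => [|i ne].
    by rewrite mxE !eqxx mulr1 addr0.
  by rewrite mxE (negPf ne) andbF mulr0.
rewrite inE /S/= in uS.
have Qle (w : 'rV[R]_n) : Q u * frob_dot w w <= Q w.
  have [w0|w0] := eqVneq (frob_dot w w) 0.
    by rewrite w0 mulr0 frob_dot_ge0.
  have wp : 0 < frob_dot w w by rewrite lt_neqAle eq_sym w0 frob_dot_ge0.
  have := umin _ (mem_set (scale_unit _ w0)).
  rewrite {2}/Q -scalemxAl frob_dotZl frob_dotZr mulrA -invfM -expr2.
  by rewrite sqr_sqrtr ?frob_dot_ge0// ler_pdivlMl// mulrC.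
have eig : eigenvalue (K^T *m K) (Q u).
  apply/eigenvalueP; exists u; last first.
    apply/eqP => u0; move: uS; rewrite u0 frob_dot0l => /esym/eqP.
    by rewrite oner_eq0.
  (* [d] is the residual of the eigenvector equation. *)
  have [d dE] : exists d, u *m (K^T *m K) = d + Q u *: u.
    by exists (u *m (K^T *m K) - Q u *: u); rewrite subrK.
  suff d0 : d = 0 by rewrite dE d0 add0r.
  (* [u] minimizes the nonnegative form [w |-> Q w - Q u * |w|^2]. *)
  apply: frob_dot_eq0; apply/eqP; rewrite eq_le frob_dot_ge0 andbT.
  rewrite -oppr_ge0 -(@pmulr_rge0 _ 2)//.
  apply: (@linear_coef_ge0 _ _ (Q d - Q u * frob_dot d d) 1) => // s _.
  have := Qle (u - s *: d).
  have -> : Q (u - s *: d) =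
      Q u - 2 * s * (frob_dot d d + Q u * frob_dot d u) + s ^+ 2 * Q d.
    rewrite -frob_dotZr -frob_dotDr -dE mulmxA frob_dot_mulmxr /Q mulmxBl.
    by rewrite -scalemxAl !frob_dot_linE (frob_dotC (u *m _) (d *m _)); ring.
  rewrite -subr_ge0 !frob_dot_linE uS (frob_dotC u d).
  by move=> h; lra.
apply: le_trans (Qle v); apply: ler_wpM2r; first exact: frob_dot_ge0.
(* [ge_inf] asks for a lower bound of the spectrum: eigenvalues of a Gram matrix are nonnegative. *)
apply: ge_inf => //; exists 0 => a /= /eigenvalueP[w wA w0].
have wp : 0 < frob_dot w w.
  rewrite lt_neqAle frob_dot_ge0 andbT eq_sym.
  by apply: contraNN w0 => /eqP/frob_dot_eq0->.
rewrite -(pmulr_lge0 _ wp) -frob_dotZl -wA mulmxA.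
by rewrite -[X in frob_dot _ X]mulmx1 frob_dotC frob_dot_mulmxr mulmx1 frob_dot_ge0.
Qed.

(** * Convex and smooth functions *)

Section convex_theory.
Context {R : realType} {p q : nat}.
Implicit Types (g : 'M[R]_(p, q) -> R) (x z v : 'M[R]_(p, q)).

Lemma convex_ineq g x z (t : R) : convex g -> 0 <= t <= 1 ->
  g (t *: x + (1 - t) *: z) <= t * g x + (1 - t) * g z.
Proof.
move=> cg t01.
have tin : t \in `[0, 1]%R by rewrite in_itv.
have := cg (Itv01 (proj1 (andP t01)) (proj2 (andP t01))) x z.
by rewrite !in_setT => /(_ isT isT).
Qed.

Lemma differential_gradient g x v :
  differentiable g x -> 'd g x v = frob_dot (gradient g x) v.
Proof.
move=> dg; rewrite [in LHS](matrix_sum_delta v) linear_sum.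
apply: eq_bigr => i _; rewrite linear_sum; apply: eq_bigr => j _.
by rewrite linearZ /= mxE mulrC.
Qed.

Lemma gradient_expansion g x v (e : R) : differentiable g x -> 0 < e ->
  exists2 d, 0 < d & forall s, 0 < s < d ->
    `|g (x + s *: v) - g x - s * frob_dot (gradient g x) v| <= e * s.
Proof.
move=> dg e0.
have := @diff_derivable _ _ _ _ _ v dg.
rewrite /derivable -/('D_v g x) (deriveE v dg) (differential_gradient v dg).
move=> /cvgrPdist_le /(_ e e0) [d /= d0 h].
exists d => // s /andP[s0 sd].
have := h s; rewrite /ball_/= sub0r normrN gtr0_norm// => /(_ sd).
rewrite gt_eqF// => /(_ isT).
set D := frob_dot _ _ => le_e.
have -> : g (x + s *: v) - g x - s * D =
    s * (s^-1 *: (g (s *: v + x) - g x) - D).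
  by rewrite mulrBr /GRing.scale/= mulVKf ?gt_eqF// (addrC x).
by rewrite normrM gtr0_norm// mulrC ler_pM2r// distrC.
Qed.

(** Convexity bounds the increment over a fraction [s] of the segment, differentiability evaluates
    it up to [e * s]; dividing by [s] leaves the error [e]. *)
Lemma convex_gradient_le g x z : convex g -> differentiable g x ->
  g x + frob_dot (gradient g x) (z - x) <= g z.
Proof.
move=> cg dg; apply/ler_addgt0Pr => e e0.
have [d d0 h] := gradient_expansion (z - x) dg e0.
pose s := Num.min d 1 / 2.
have s0 : 0 < s by rewrite divr_gt0// lt_min d0 ltr01.
have [sd s1] : s < d /\ s < 1.
  have : s * 2 = Num.min d 1 by rewrite mulfVK.
  by have := ge_min d d 1; have := ge_min 1 d 1; rewrite !lexx orbT; lra.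
have /h : 0 < s < d by rewrite s0.
rewrite ler_norml => /andP[+ _].
have : g (x + s *: (z - x)) <= s * g z + (1 - s) * g x.
  have -> : x + s *: (z - x) = s *: z + (1 - s) *: x.
    by apply/matrixP => i j; rewrite !mxE; ring.
  by apply: convex_ineq => //; rewrite !ltW.
set D := frob_dot _ _ => h1 h2.
by rewrite -(ler_pM2l s0); lra.
Qed.

(** Fermat's rule for [g + <w, .>] plus a quadratic, whose coefficient [c] may depend on the
    direction. Testing with [v = - (gradient g x + w)] bounds the squared norm of that sum by every
    [e > 0]. *)
Lemma gradient_stationary g x w : differentiable g x ->
  (forall v, exists c, forall s, 0 < s < 1 ->
     g x <= g (x + s *: v) + s * frob_dot w v + s ^+ 2 * c) ->
  gradient g x = - w.
Proof.
move=> dg gmin; apply/eqP; rewrite -addr_eq0; apply/eqP/frob_dot_eq0/eqP.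
rewrite eq_le frob_dot_ge0 andbT; set u := gradient g x + w.
apply/ler_addgt0Pr => e e0; rewrite add0r.
have [c cP] := gmin (- u); have [d d0 h] := gradient_expansion (- u) dg e0.
rewrite -subr_ge0.
apply: (@linear_coef_ge0 _ _ c (Num.min d 1)); first by rewrite lt_min d0 ltr01.
move=> s; rewrite lt_min => /and3P[s0 sd s1].
have /h : 0 < s < d by rewrite s0.
rewrite ler_norml => /andP[_ h1]; have /cP h2 : 0 < s < 1 by rewrite s0.
have -> : frob_dot u u = frob_dot (gradient g x) u + frob_dot w u.
  by rewrite -frob_dotDl.
by rewrite !frob_dotNr in h1 h2; lra.
Qed.

(** Optimality of a proximal point without differentiating [g]: compare [x] with points of the
    segment towards [z], where convexity bounds [g] and the quadratic contributes only to second
    order beyond its linear part. *)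
Lemma prox_subgradient g (rho : R) x w : convex g ->
  (forall z, g x + rho / 2 * frob (x - w) ^+ 2
             <= g z + rho / 2 * frob (z - w) ^+ 2) ->
  forall z, g x + frob_dot (rho *: (w - x)) (z - x) <= g z.
Proof.
move=> cg gmin z; rewrite -subr_ge0.
apply: (@linear_coef_ge0 _ _ (rho / 2 * frob_dot (z - x) (z - x)) 1) => //.
move=> s /andP[s0 s1].
have := gmin (s *: z + (1 - s) *: x).
have s01 : 0 <= s <= 1 by rewrite !ltW.
have := @convex_ineq g z x s cg s01.
have -> : s *: z + (1 - s) *: x - w = (x - w) + s *: (z - x).
  by apply/matrixP => i j; rewrite !mxE; ring.
rewrite -(opprB x w) !sqr_frob.
move: (x - w) (z - x) => a b; rewrite !frob_dot_linE (frob_dotC b a).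
by move=> h1 h2; lra.
Qed.

(* The telescoping over three equal steps costs the constant 2/3 instead of the
   sharp 1/2, but needs no integration; the descent condition on the penalty
   tolerates any constant below 1 / sqrt 2. *)
Lemma descent_le g (G : 'M[R]_(p, q) -> 'M[R]_(p, q)) (L : R) x z :
  (forall x z, g x + frob_dot (G x) (z - x) <= g z) ->
  (forall x z, frob (G x - G z) <= L * frob (x - z)) ->
  g z <= g x + frob_dot (G x) (z - x) + 2 / 3 * L * frob_dot (z - x) (z - x).
Proof.
move=> gG GL; pose d := 3^-1 *: (z - x).
have zE : z = x + 3 *: d by rewrite scalerA mulfV// scale1r addrC subrK.
(* At the far end of this step the gradient differs from [G x] by at most [(k + 1) * L * |d|]. The
   total factor 1 + 2 + 3 = 6, with [|d|^2 = |z - x|^2 / 9], gives 2/3. *)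
have step (k : R) : 0 <= k ->
    g (x + (k + 1) *: d) - g (x + k *: d)
    <= frob_dot (G x) d + (k + 1) * L * frob_dot d d.
  move=> k0; have := gG (x + (k + 1) *: d) (x + k *: d).
  have -> : x + k *: d - (x + (k + 1) *: d) = - d.
    by apply/matrixP => i j; rewrite !mxE; ring.
  rewrite frob_dotNr.
  have : frob_dot (G (x + (k + 1) *: d) - G x) d <= (k + 1) * L * frob_dot d d.
    apply: le_trans (frob_dot_le_frob _ _) _.
    rewrite -sqr_frob expr2 mulrA ler_wpM2r ?frob_ge0//.
    apply: le_trans (GL _ _) _; rewrite addrC addKr.
    have -> : frob ((k + 1) *: d) = (k + 1) * frob d; last by rewrite mulrCA mulrA.
    rewrite /frob frob_dotZl frob_dotZr mulrA -expr2 sqrtrM ?sqr_ge0//.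
    by rewrite sqrtr_sqr ger0_norm// addr_ge0.
  by rewrite frob_dotDl frob_dotNl; lra.
have := step 0 (lexx 0); have := step 1 ler01; have := step 2 (ler0n _ 2).
rewrite scale0r addr0 add0r.
have -> : (1 + 1 : R) = 2 by []; have -> : (2 + 1 : R) = 3 by lra.
rewrite -zE; have -> : z - x = 3 *: d by rewrite zE addrC addKr.
by rewrite !frob_dot_linE; lra.
Qed.

End convex_theory.

(** * Monotone sequences and the Fejer inequality *)

Lemma cvg_decrements (R : realType) (W d : nat -> R) (b : R) :
  (forall t, b <= W t) -> (forall t, 0 <= d t) ->
  (forall t, W t.+1 <= W t - d t) -> d @ \oo --> (0 : R).
Proof.
move=> Wb d0 Wd.
have Wni : nonincreasing_seq W.
  by apply/nonincreasing_seqP => t; have := Wd t; have := d0 t; lra.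
have cW : cvgn W.
  by apply: nonincreasing_is_cvgn => //; exists b => _ [t _ <-].
apply: (@squeeze_cvgr _ _ _ _ (fun=> 0) (fun t => W t - W t.+1)).
- by apply: nearW => t; rewrite d0/=; have := Wd t; lra.
- exact: cvg_cst.
- rewrite -(subrr (limn W)); apply: cvgB => //.
  by rewrite (cvg_shiftS W).
Qed.

Lemma cvg_subseq_nat (s : nat -> nat) :
  (forall j, (j <= s j)%N) -> s @ \oo --> \oo.
Proof.
move=> sj; apply/cvgnyPge => A; near=> j; apply: leq_trans (sj j).
by near: j; exact: nbhs_infty_ge.
Unshelve. all: by end_near. Qed.

(* One step of the Fejer argument: [e], [e'] are the errors of two successive
   multipliers and [a], [a'] those of [K *m alpha]. *)
Lemma fejer_step (R : realType) (p q : nat) (rho : R) (e e' a a' : 'M[R]_(p, q)) :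
  0 < rho ->
  0 <= frob_dot (e' + rho *: (a - a')) (a' - rho^-1 *: (e' - e)) ->
  frob_dot e' a' <= 0 -> frob_dot (e' - e) (a' - a) <= 0 ->
  rho^-1 * frob_dot e' e' + rho * frob_dot a' a'
  <= rho^-1 * frob_dot e e + rho * frob_dot a a.
Proof.
move=> rho0 h1 h2 h3.
have k0 : 0 < rho^-1 by rewrite invr_gt0.
have E1 : 0 <= rho^-1 * frob_dot (e' - e) (e' - e).
  by rewrite pmulr_rge0// frob_dot_ge0.
have E2 : 0 <= rho * frob_dot (a - a') (a - a') by rewrite pmulr_rge0// frob_dot_ge0.
(* When [h1] is expanded, the product of the two increments has coefficient [rho * rho^-1 = 1] and
   becomes the term of [h3]. Polarization turns the other products into differences of squares, up
   to [E1] and [E2]. *)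
have E3 : 0 <= frob_dot e' a' - rho^-1 * frob_dot e' (e' - e)
    + rho * frob_dot (a - a') a' + frob_dot (e' - e) (a' - a).
  apply: le_trans h1 _; move: k0 (mulfV (lt0r_neq0 rho0)); set k := rho^-1 => k0 rk.
  have -> : frob_dot (e' - e) (a' - a) = - (rho * k) * frob_dot (a - a') (e' - e).
    by rewrite rk mulN1r -frob_dotNl opprB frob_dotC.
  by move: (a - a') (e' - e) => u v; rewrite !frob_dot_linE; lra.
move: E1 E2 E3; rewrite !frob_dot_linE (frob_dotC e e') (frob_dotC a a').
rewrite !frob_dot_linE in h3.
by lra.
Qed.

(** * Convergence of the iteration for a fixed penalty *)

Section admm_convergence.
Context {R : realType} {n q : nat}.
Variables (K : 'M[R]_n) (sig rho L delta : R).
Hypothesis K_sym : K^T = K.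
Hypothesis sig_gt0 : 0 < sig.
Hypothesis K_lower : forall p (X : 'M[R]_(n, p)),
  sig * frob_dot X X <= frob_dot (K *m X) (K *m X).
Hypothesis rho_gt0 : 0 < rho.
Hypothesis delta_gt0 : 0 < delta.
Hypothesis rho_large : 2 * L ^+ 2 < (rho * sig) ^+ 2.
Variables (f : 'M[R]_(n, q) -> R) (G : 'M[R]_(n, q) -> 'M[R]_(n, q)).
Hypothesis f_lb : lower_bounded f.
Hypothesis f_gradient : forall x z, f x + frob_dot (G x) (z - x) <= f z.
Hypothesis G_lip : forall x z, frob (G x - G z) <= L * frob (x - z).
Hypothesis f_coercive : forall C, exists D,
  forall x, f x <= C -> frob_dot (K *m x) (K *m x) <= D.
Variable loss : 'I_q -> 'rV[R]_q -> R.
Hypothesis loss_lb : forall k, lower_bounded (loss k).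
Hypothesis loss_lsc : forall k, lower_semicontinuous (EFin \o loss k).
Variable E : {ffun 'I_n -> 'I_q} -> R.

(** Real-valued form of [lagrangian]: the argument runs on feasible labelings, where all energies
    are finite. *)
Definition real_lagrangian (a b l : 'M[R]_(n, q)) (y : {ffun 'I_n -> 'I_q}) : R :=
  \sum_i loss (y i) (row i b) + f a + E y
  + (frob_dot l (K *m a - b) + rho / 2 * frob_dot (K *m a - b) (K *m a - b)).

Lemma frob_dot_sym (A B : 'M[R]_(n, q)) : frob_dot A (K *m B) = frob_dot (K *m A) B.
Proof. by rewrite frob_dot_mulmx K_sym. Qed.

Lemma G_lip_sq x z :
  frob_dot (G x - G z) (G x - G z) <= L ^+ 2 * frob_dot (x - z) (x - z).
Proof.
rewrite -!sqr_frob -exprMn ler_sqr ?nnegrE ?frob_ge0//.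
exact: le_trans (frob_ge0 _) (G_lip x z).
Qed.

Lemma G_monotone x z : 0 <= frob_dot (G x - G z) (x - z).
Proof.
have := f_gradient x z; have := f_gradient z x.
by rewrite -(opprB x z) frob_dotNr frob_dotDl frob_dotNl => *; lra.
Qed.

Lemma K_unit : K \in unitmx.
Proof.
rewrite -row_free_unit; apply: inj_row_free => v vK; apply: trmx_inj.
rewrite trmx0; apply: frob_dot_eq0; apply/eqP; rewrite eq_le frob_dot_ge0 andbT.
rewrite -(pmulr_rle0 _ sig_gt0); apply: le_trans (K_lower _) _.
by rewrite -[K]trmxK K_sym -trmx_mul vK trmx0 frob_dot0l.
Qed.

(** [y0] is the updated multiplier, and [K *m y0 = - G a'] is the stationarity of [a']. The gain
    comes from the quadratic penalty, strongly convex by [K_lower]; [f] enters through its gradient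
    inequality at [a']. *)
Lemma alpha_step (a a' b l y0 : _) (y : {ffun 'I_n -> 'I_q}) :
  y0 = l + rho *: (K *m a' - b) -> K *m y0 = - G a' ->
  real_lagrangian a' b l y + rho / 2 * (sig * frob_dot (a' - a) (a' - a))
  <= real_lagrangian a b l y.
Proof.
move=> y0E Gy0; have := f_gradient a' a.
rewrite -[G a']opprK -Gy0 frob_dotNl -frob_dot_sym y0E mulmxBr.
have := K_lower (a' - a); rewrite mulmxBr /real_lagrangian.
rewrite -(ler_pM2l (divr_gt0 rho_gt0 (ltr0n R 2))).
move: (K *m a') (K *m a) => u v.
have -> : u - v = (u - b) - (v - b) by rewrite opprB addrA subrK.
have -> : v - u = (v - b) - (u - b) by rewrite opprB addrA subrK.
move: (u - b) (v - b) => {}u {}v.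
by rewrite !frob_dot_linE (frob_dotC u v) => h1 h2; lra.
Qed.

(** By [K_lower], [sig * |l' - l|^2] is at most [|K (l' - l)|^2 = |G a' - G a|^2]. *)
Lemma multiplier_diff_le (a a' l l' : 'M[R]_(n, q)) :
  K *m l = - G a -> K *m l' = - G a' ->
  frob_dot (l' - l) (l' - l) <= sig^-1 * L ^+ 2 * frob_dot (a' - a) (a' - a).
Proof.
move=> Kl Kl'; rewrite -mulrA ler_pdivlMl//.
apply: le_trans (K_lower _) _; rewrite mulmxBr Kl Kl' -opprD frob_dotNl frob_dotNr opprK.
exact: G_lip_sq.
Qed.

(** Gain of the alpha-step minus cost of the multiplier step; times [rho * sig] it is
    [(rho * sig)^2 / 2 - L^2]. *)
Lemma penalty_margin_step : 0 < rho / 2 * sig - rho^-1 * (sig^-1 * L ^+ 2).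
Proof.
have rs : 0 < rho * sig by rewrite mulr_gt0.
rewrite -(pmulr_rgt0 _ rs).
have -> : rho * sig * (rho / 2 * sig - rho^-1 * (sig^-1 * L ^+ 2))
  = (rho * sig) ^+ 2 / 2 - (rho * rho^-1) * (sig * sig^-1) * L ^+ 2 by ring.
by rewrite !mulfV ?lt0r_neq0// !mul1r subr_gt0 ltr_pdivlMr// mulrC.
Qed.

(** The 2/3 is that of [descent_le]; it is affordable because [(4/3)^2 < 2]. *)
Lemma penalty_margin_lower : 0 < rho / 2 * sig - 2 / 3 * L.
Proof.
have rs : 0 < rho * sig by rewrite mulr_gt0.
have [L0|L0] := leP L 0; first by nra.
have : 4 / 3 * L < rho * sig; last by lra.
rewrite -(@ltr_pXn2r _ 2) ?nnegrE//; [|lra|exact: ltW].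
rewrite exprMn; move: rho_large (sqr_ge0 L).
by move: (L ^+ 2) ((rho * sig) ^+ 2) => u v uv u0; lra.
Qed.

(** With [b = K x], stationarity turns [<l, K a - b>] into [<G a, x - a>]. By [descent_le], adding
    [f a] gives at least [f x] minus a quadratic error, which the penalty absorbs. *)
Lemma lagrangian_lower (a b l : 'M[R]_(n, q)) (y : {ffun 'I_n -> 'I_q}) :
  K *m l = - G a ->
  \sum_i loss (y i) (row i b) + f (invmx K *m b) + E y
  + (rho / 2 * sig - 2 / 3 * L) * frob_dot (invmx K *m b - a) (invmx K *m b - a)
  <= real_lagrangian a b l y.
Proof.
move=> Kl; have bE : b = K *m (invmx K *m b) by rewrite mulKVmx// K_unit.
rewrite /real_lagrangian; move: (invmx K *m b) bE => x ->.
have := descent_le a x f_gradient G_lip.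
have -> : K *m a - K *m x = - (K *m (x - a)) by rewrite -mulmxBr -mulmxN opprB.
rewrite !frob_dotNr frob_dotNl opprK frob_dot_sym Kl frob_dotNl opprK.
have := K_lower (x - a).
rewrite -(ler_pM2l (divr_gt0 rho_gt0 (ltr0n R 2))).
by move=> h1 h2; lra.
Qed.

(** * Descent of the Lagrangian along the iterates, and boundedness *)

Variables (al be la : nat -> 'M[R]_(n, q)) (y : nat -> {ffun 'I_n -> 'I_q}).
Hypothesis la_stationary : forall t, K *m la t = - G (al t).
Hypothesis la_step : forall t, la t.+1 = la t + rho *: (K *m al t.+1 - be t.+1).
Hypothesis be_subgradient : forall t i b,
  loss (y t.+1 i) (row i (be t.+1))
  + frob_dot (row i (la t + rho *: (K *m al t - be t.+1))) (b - row i (be t.+1))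
  <= loss (y t.+1 i) b.
Hypothesis label_step : forall t,
  real_lagrangian (al t) (be t.+1) (la t) (y t.+1)
  <= real_lagrangian (al t) (be t) (la t) (y t) - (y t.+1 != y t)%:R * delta.

Let W t := real_lagrangian (al t) (be t) (la t) (y t).
Let margin := rho / 2 * sig - rho^-1 * (sig^-1 * L ^+ 2).

Lemma lagrangian_descent t :
  W t.+1 <= W t - (margin * frob_dot (al t.+1 - al t) (al t.+1 - al t)
                   + (y t.+1 != y t)%:R * delta).
Proof.
have step_a := alpha_step (al t) (y t.+1) (la_step t) (la_stationary t.+1).
have step_l := multiplier_diff_le (la_stationary t) (la_stationary t.+1).
have rE : rho *: (K *m al t.+1 - be t.+1) = la t.+1 - la t.
  by rewrite la_step addrAC subrr add0r.
(* The multiplier step adds [<la t.+1 - la t, K al - be>] at [t.+1], and that residual is [rho^-1]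
   times the same increment. *)
have W1 : W t.+1 = real_lagrangian (al t.+1) (be t.+1) (la t) (y t.+1)
    + rho^-1 * frob_dot (la t.+1 - la t) (la t.+1 - la t).
  rewrite -{1}rE frob_dotZl mulKf ?gt_eqF// frob_dotC frob_dotDl frob_dotNl.
  by rewrite /W /real_lagrangian; ring.
have r0 : 0 < rho^-1 by rewrite invr_gt0.
have := label_step t; rewrite -(ler_pM2l r0) in step_l.
by rewrite W1 -/(W t) /margin; lra.
Qed.

Lemma loss_sum_lb : exists c, forall (z : {ffun 'I_n -> 'I_q}) (b : 'M[R]_(n, q)),
  c <= \sum_i loss (z i) (row i b).
Proof.
have /choice[c cP] : forall k, exists c, forall b, c <= loss k b.
  by move=> k; have [c cP] := loss_lb k; exists c => b; apply: cP; exists b.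
(* There are finitely many labels, so one sum bounds every [c k], whatever the labeling. *)
exists (\sum_(i < n) - \sum_k `|c k|) => z b; apply: ler_sum => i _.
apply: le_trans (cP (z i) _); rewrite lerNl; apply: le_trans (ler_norm _) _.
by rewrite normrN (bigD1 (z i))//= lerDl sumr_ge0.
Qed.

Lemma energy_lb : exists c, forall z, c <= E z.
Proof.
exists (- \sum_z `|E z|) => z; rewrite lerNl; apply: le_trans (ler_norm _) _.
by rewrite normrN (bigD1 z)//= lerDl sumr_ge0.
Qed.

Lemma W_nonincreasing t : W t <= W 0%N.
Proof.
elim: t => // t; apply: le_trans; apply: le_trans (lagrangian_descent t) _.
rewrite gerBl addr_ge0// mulr_ge0 ?frob_dot_ge0 ?ler0n// ltW//.
exact: penalty_margin_step.
Qed.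

Lemma W_lb : exists c, forall t, c <= W t.
Proof.
have [c1 c1P] := loss_sum_lb; have [c2 c2P] := energy_lb; have [c3 c3P] := f_lb.
exists (c1 + c3 + c2) => t.
apply: le_trans (lagrangian_lower (be t) (y t) (la_stationary t)).
rewrite -[leLHS]addr0 lerD//; last first.
  by rewrite mulr_ge0 ?frob_dot_ge0// ltW// penalty_margin_lower.
by rewrite !lerD//; apply: c3P; exists (invmx K *m be t).
Qed.

Lemma decrements_cvg0 :
  (fun t => margin * frob_dot (al t.+1 - al t) (al t.+1 - al t)
            + (y t.+1 != y t)%:R * delta) @ \oo --> (0 : R).
Proof.
have [c cP] := W_lb.
apply: (cvg_decrements cP) => t; last exact: lagrangian_descent.
rewrite addr_ge0// mulr_ge0 ?frob_dot_ge0 ?ler0n// ltW//.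
exact: penalty_margin_step.
Qed.

Lemma alpha_diff_cvg0 :
  (fun t => frob_dot (al t.+1 - al t) (al t.+1 - al t)) @ \oo --> (0 : R).
Proof.
have m0 := penalty_margin_step.
apply: (@squeeze_cvgr _ _ _ _ (fun=> 0) (fun t => margin^-1 *
  (margin * frob_dot (al t.+1 - al t) (al t.+1 - al t)
            + (y t.+1 != y t)%:R * delta))).
- apply: nearW => t; rewrite frob_dot_ge0/= mulrDr mulKf ?gt_eqF//.
  by rewrite lerDl !mulr_ge0 ?ler0n ?invr_ge0 ?ltW.
- exact: cvg_cst.
- rewrite -[X in _ --> X](mulr0 margin^-1).
  by apply: cvgM; [exact: cvg_cst|exact: decrements_cvg0].
Qed.

Lemma label_stable : exists T ys, forall t, (T <= t)%N -> y t = ys.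
Proof.
(* A label change makes the decrement at least [delta], which is impossible once decrements are
   smaller. *)
have /cvgr0Pnorm_lt/(_ _ delta_gt0)[T _ TP] := decrements_cvg0.
exists T, (y T) => t /subnK <-; elim: (t - T)%N => // k <-.
have := TP (k + T)%N (leq_addl _ _); rewrite /= -addSn.
apply: contraTeq => ->; rewrite mul1r -leNgt.
apply: le_trans (ler_norm _); rewrite lerDr mulr_ge0 ?frob_dot_ge0// ltW//.
exact: penalty_margin_step.
Qed.

(** [lagrangian_lower] bounds two things at [x = K^-1 be t]: the value [f x], hence [x] by
    coercivity, and the distance from [x] to [al t]. *)
Lemma alpha_bounded : exists C, forall t, frob_dot (al t) (al t) <= C.
Proof.
have [c1 c1P] := loss_sum_lb; have [c2 c2P] := energy_lb; have [c3 c3P] := f_lb.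
have [D DP] := f_coercive (W 0%N - c1 - c2).
have m0 := penalty_margin_lower; set mu := _ - _ in m0.
exists (2 * (sig^-1 * D) + 2 * (mu^-1 * (W 0%N - c1 - c2 - c3))) => t.
have := le_trans (lagrangian_lower (be t) (y t) (la_stationary t)) (W_nonincreasing t).
rewrite -/mu; set x := invmx K *m be t => h.
have d0 : 0 <= mu * frob_dot (x - al t) (x - al t) by rewrite mulr_ge0 ?frob_dot_ge0// ltW.
have := c1P (y t) (be t); have := c2P (y t) => h2 h1.
have h3 : c3 <= f x by apply: c3P; exists x.
have xD : frob_dot x x <= sig^-1 * D.
  by rewrite ler_pdivlMl//; apply: le_trans (K_lower _) _; apply: DP; lra.
have dD : frob_dot (al t - x) (al t - x) <= mu^-1 * (W 0%N - c1 - c2 - c3).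
  by rewrite ler_pdivlMl// -opprB frob_dotNl frob_dotNr opprK; lra.
by have := frob_dotD_le x (al t - x); rewrite subrKC; lra.
Qed.

(** * Cluster points and Fejer monotonicity *)

Lemma cvg_multiplier (s : nat -> nat) (a : 'M[R]_(n, q)) :
  al \o s @ \oo --> a -> la \o s @ \oo --> invmx K *m - G a.
Proof.
move=> /cvg_frob_dotP sa; apply/cvg_frob_dotP.
apply: (@squeeze_cvgr _ _ _ _ (fun=> 0) (fun k => sig^-1 * L ^+ 2 *
  frob_dot (al (s k) - a) (al (s k) - a))).
- apply: nearW => k; rewrite frob_dot_ge0/=.
  by apply: multiplier_diff_le => //; rewrite mulKVmx// K_unit.
- exact: cvg_cst.
- by rewrite -[X in _ --> X](mulr0 (sig^-1 * L ^+ 2)); apply: cvgM => //; exact: cvg_cst.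
Qed.

Lemma beE t : be t.+1 = K *m al t.+1 - rho^-1 *: (la t.+1 - la t).
Proof.
by rewrite la_step addrAC subrr add0r scalerA mulVf ?gt_eqF// scale1r subKr.
Qed.


Lemma dual_residual_cvg0 (s : nat -> nat) :
  s @ \oo --> \oo ->
  (fun k => la (s k).+1 - la (s k)) @ \oo --> (0 : 'M[R]_(n, q)).
Proof.
move=> s_oo; have := cvg_comp _ _ s_oo alpha_diff_cvg0.
move=> h; apply/cvg_frob_dotP.
apply: (@squeeze_cvgr _ _ _ _ (fun=> 0) (fun k => sig^-1 * L ^+ 2 *
  frob_dot (al (s k).+1 - al (s k)) (al (s k).+1 - al (s k)))).
- by apply: nearW => k; rewrite frob_dot_ge0/= subr0 multiplier_diff_le.
- exact: cvg_cst.
- rewrite -[X in _ --> X](mulr0 (sig^-1 * L ^+ 2)); apply: cvgM => //.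
  exact: cvg_cst.
Qed.

Lemma cvg_succ (s : nat -> nat) (a : 'M[R]_(n, q)) : s @ \oo --> \oo ->
  al \o s @ \oo --> a -> (fun k => al (s k).+1) @ \oo --> a.
Proof.
move=> s_oo sa; rewrite -[a]add0r.
have -> : (fun k => al (s k).+1) = (fun k => (al (s k).+1 - al (s k)) + al (s k)).
  by apply/funext => k; rewrite subrK.
apply: cvgD => //; apply/cvg_frob_dotP.
under eq_fun do rewrite subr0.
exact: (cvg_comp _ _ s_oo alpha_diff_cvg0).
Qed.

Lemma cvg_beta (s : nat -> nat) (a : 'M[R]_(n, q)) : s @ \oo --> \oo ->
  al \o s @ \oo --> a -> (fun k => be (s k).+1) @ \oo --> K *m a.
Proof.
move=> s_oo sa.
have -> : (fun k => be (s k).+1) =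
    (fun k => K *m al (s k).+1 - rho^-1 *: (la (s k).+1 - la (s k))).
  by apply/funext => k; rewrite beE.
rewrite -[K *m a]subr0 -(scaler0 _ rho^-1).
apply: cvgB; first by apply: cvg_mulmx; exact: cvg_succ.
by apply: cvgZr; exact: dual_residual_cvg0.
Qed.

(** Closedness of the subgradient inequality. The subgradients [nu k] tend to the limit multiplier
    since successive differences vanish. Lower semicontinuity suffices, as only the smaller side has
    a moving loss argument; it takes one [e / 2], the inner product the other. *)
Lemma limit_subgradient (s : nat -> nat) (a : 'M[R]_(n, q)) T ys :
  (forall t, (T <= t)%N -> y t = ys) -> s @ \oo --> \oo -> al \o s @ \oo --> a ->
  forall i b, loss (ys i) (row i (K *m a))
    + frob_dot (row i (invmx K *m - G a)) (b - row i (K *m a)) <= loss (ys i) b.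
Proof.
move=> yT s_oo sa i b.
pose nu k := la (s k) + rho *: (K *m al (s k) - be (s k).+1).
have nu_cvg : nu @ \oo --> invmx K *m - G a.
  rewrite -[X in _ --> X]addr0 -(scaler0 _ rho) -(subrr (K *m a)).
  apply: cvgD; first exact: cvg_multiplier.
  by apply: cvgZr; apply: cvgB; [exact: cvg_mulmx|exact: cvg_beta].
have dot_cvg : (fun k => frob_dot (row i (nu k)) (b - row i (be (s k).+1))) @ \oo
    --> frob_dot (row i (invmx K *m - G a)) (b - row i (K *m a)).
  apply: cvg_frob_dot; first exact: cvg_row.
  apply: cvgB; [exact: cvg_cst|apply: cvg_row; exact: cvg_beta].
apply/ler_addgt0Pr => e e0; have e20 : 0 < e / 2 by rewrite divr_gt0.
have [|V Vx VP] := @loss_lsc (ys i) (row i (K *m a))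
  (loss (ys i) (row i (K *m a)) - e / 2).
  by rewrite lte_fin gtrBl.
have near_V : \forall k \near \oo, V (row i (be (s k).+1)).
  by have := cvg_row (cvg_beta s_oo sa); apply.
have near_T : \forall k \near \oo, (T <= s k)%N.
  by move/cvgnyPge: s_oo; apply.
have near_dot : \forall k \near \oo,
    frob_dot (row i (invmx K *m - G a)) (b - row i (K *m a)) - e / 2
    < frob_dot (row i (nu k)) (b - row i (be (s k).+1)).
  by move/cvgrPdist_lt: dot_cvg => /(_ _ e20); apply: filterS => k;
    rewrite ltr_norml => /andP[_]; lra.
near \oo => k.
have yk : y (s k).+1 = ys by apply: yT; apply: leqW; near: k.
have := be_subgradient (s k) i b; rewrite yk -/(nu k).
have /VP : V (row i (be (s k).+1)) by near: k.
rewrite lte_fin => h1 h2.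
have h3 : frob_dot (row i (invmx K *m - G a)) (b - row i (K *m a)) - e / 2 <
  frob_dot (row i (nu k)) (b - row i (be (s k).+1)) by near: k.
by lra.
Unshelve. all: by end_near. Qed.

Let potential (a l : 'M[R]_(n, q)) t := rho^-1 * frob_dot (la t - l) (la t - l)
  + rho * frob_dot (K *m (al t - a)) (K *m (al t - a)).

(** The hypotheses of [fejer_step] are three monotonicities: of the loss subgradients between
    [be t.+1] and [K *m a], and of [G] between [al t.+1] and first [a], then [al t]. Stationarity
    translates [G] into multipliers. *)
Lemma fejer (a l : 'M[R]_(n, q)) ys t :
  y t.+1 = ys -> K *m l = - G a ->
  (forall i b, loss (ys i) (row i (K *m a))
    + frob_dot (row i l) (b - row i (K *m a)) <= loss (ys i) b) ->
  potential a l t.+1 <= potential a l t.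
Proof.
move=> yt Kl sub; apply: fejer_step => //.
- have -> : la t.+1 - l + rho *: (K *m (al t - a) - K *m (al t.+1 - a)) =
      (la t + rho *: (K *m al t - be t.+1)) - l.
    rewrite la_step !mulmxBr; move: (K *m al t) (K *m al t.+1) (K *m a) => u v w.
    by apply/matrixP => i j; rewrite !mxE; ring.
  have -> : K *m (al t.+1 - a) - rho^-1 *: (la t.+1 - l - (la t - l)) =
      be t.+1 - K *m a.
    rewrite beE mulmxBr; move: (K *m al t) (K *m al t.+1) (K *m a) => u v w.
    by apply/matrixP => i j; rewrite !mxE; ring.
  rewrite frob_dot_rows; apply: sumr_ge0 => i _.
  have := sub i (row i (be t.+1)); have := be_subgradient t i (row i (K *m a)).
  rewrite yt; set nu := la t + _.
  rewrite !linearB/= -(opprB (row i (be t.+1))).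
  move: (row i (be t.+1) - _) => d.
  by rewrite frob_dotNr frob_dotDl frob_dotNl => h1 h2; lra.
- have := G_monotone (al t.+1) a.
  rewrite -[G (al t.+1)]opprK -[G a]opprK -la_stationary -Kl -opprD -mulmxBr.
  by rewrite frob_dotNl frob_dot_sym oppr_ge0.
- have := G_monotone (al t.+1) (al t).
  rewrite -[G (al t.+1)]opprK -[G (al t)]opprK -!la_stationary -opprD -mulmxBr.
  rewrite frob_dotNl oppr_ge0 -frob_dot_sym => h.
  have -> : la t.+1 - l - (la t - l) = la t.+1 - la t.
    by apply/matrixP => i j; rewrite !mxE; ring.
  rewrite -mulmxBr; have -> // : al t.+1 - a - (al t - a) = al t.+1 - al t.
  by apply/matrixP => i j; rewrite !mxE; ring.
Qed.

Lemma admm_cvg : exists a l ys,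
  [/\ [/\ al @ \oo --> a, be @ \oo --> K *m a, la @ \oo --> l
        & \forall t \near \oo, y t = ys],
      K *m l = - G a
    & forall i b, loss (ys i) (row i (K *m a))
        + frob_dot (row i l) (b - row i (K *m a)) <= loss (ys i) b].
Proof.
have [T [ys yT]] := label_stable; have [C alC] := alpha_bounded.
have [s [a [sk sa]]] := bounded_matrix_subseq alC.
have s_oo := cvg_subseq_nat sk.
pose l := invmx K *m - G a.
have Kl : K *m l = - G a by rewrite mulKVmx// K_unit.
have sub := limit_subgradient yT s_oo sa; rewrite -/l in sub.
pose V := potential a l.
have r0 : 0 < rho^-1 by rewrite invr_gt0.
(* Monotone only after the labels have settled at [ys]. *)
have V_decr k t : (T <= k)%N -> (k <= t)%N -> V t <= V k.
  move=> Tk /subnK <-; elim: (t - k)%N => // j; apply: le_trans.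
  apply: fejer Kl sub; apply: yT; apply: leqW; exact: leq_trans (leq_addl _ _).
have V_s : V \o s @ \oo --> (0 : R).
  rewrite -[X in _ --> X]addr0 -[X in X + _](mulr0 rho^-1) -[X in _ + X](mulr0 rho).
  apply: cvgD; apply: cvgM; do ?exact: cvg_cst.
    by have /cvg_frob_dotP := cvg_multiplier sa.
  have /cvg_frob_dotP : (fun k => K *m al (s k)) @ \oo --> K *m a by exact: cvg_mulmx.
  by under eq_fun do rewrite -mulmxBr.
(* One late index of the subsequence with a small value controls all later values. *)
have V_cvg : V @ \oo --> (0 : R).
  apply/cvgr0Pnorm_le => e e0.
  have near_T : \forall k \near \oo, (T <= s k)%N by move/cvgnyPge: s_oo; apply.
  have near_e : \forall k \near \oo, `|(V \o s) k| <= e by move/cvgr0Pnorm_le: V_s; apply.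
  near \oo => k; exists (s k) => // t /= kt.
  have V0 : 0 <= V t by rewrite addr_ge0// mulr_ge0 ?frob_dot_ge0// ltW.
  rewrite ger0_norm//; apply: le_trans (V_decr _ _ _ kt) _; first by near: k.
  by apply: le_trans (ler_norm _) _; near: k.
(* [V t] dominates [rho * sig * |al t - a|^2]; the limits of [be] and [la] then follow with [s] the
   identity. *)
have a_cvg : al @ \oo --> a.
  apply/cvg_frob_dotP; apply: (@squeeze_cvgr _ _ _ _ (fun=> 0)
    (fun t => (sig^-1 * rho^-1) * V t)).
  - apply: nearW => t; rewrite frob_dot_ge0/= -mulrA ler_pdivlMl//.
    apply: le_trans (K_lower _) _; rewrite /V /potential mulrDr mulKf ?gt_eqF// lerDr.
    by rewrite !mulr_ge0 ?frob_dot_ge0// ltW.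
  - exact: cvg_cst.
  - by rewrite -[X in _ --> X](mulr0 (sig^-1 * rho^-1)); apply: cvgM => //; exact: cvg_cst.
exists a, l, ys; split=> //; split=> //.
- by rewrite -(cvg_shiftS be); apply: (@cvg_beta id) => //; exact: cvg_id.
- exact: (@cvg_multiplier id).
- by exists T => // t /= /yT.
Unshelve. all: by end_near. Qed.

End admm_convergence.

(** * The kernel model and the runs of the algorithm *)

Section feature_dot_theory.
Context {R : realType} {U : lmodType R} (d : {dot U for idfun}).

Lemma dotC u v : d u v = d v u.
Proof. by rewrite hermC expr0 mul1r. Qed.

Lemma dotBZl a b u v w : d (a *: u - b *: v) w = a * d u w - b * d v w.
Proof. by rewrite dotC linearB !linearZ/= !(dotC w). Qed.

Lemma dot_ge0 u : 0 <= d u u.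
Proof.
have [->|u0] := eqVneq u 0; first by rewrite linear0.
exact/ltW/neq0_dnorm_gt0.
Qed.

Lemma dot_CS u v : d u v ^+ 2 <= d u u * d v v.
Proof.
have [->|v0] := eqVneq v 0; first by rewrite !linear0 mulr0 expr0n.
have vp : 0 < d v v by exact: neq0_dnorm_gt0.
have := dot_ge0 (d v v *: u - d u v *: v).
rewrite dotBZl !(dotC _ (_ - _)) !dotBZl (dotC v u) => h.
rewrite -subr_ge0 -(pmulr_rge0 _ vp); apply: le_trans h _.
by rewrite le_eqVlt; apply/orP; left; apply/eqP; ring.
Qed.

End feature_dot_theory.

(** * The feature norm, coercivity and the extended-real Lagrangian *)

Section model_theory.
Context {R : realType} {n q : nat} (M : dc_model R n q).
Local Notation K := (kernel M).
Local Notation f := (regularizer M).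

Lemma kernel_sym : K^T = K.
Proof. by apply/matrixP => i j; rewrite !mxE dotC. Qed.

Lemma sigma_kernel_le p (X : 'M[R]_(n, p)) :
  sigma M * frob_dot X X <= frob_dot (K *m X) (K *m X).
Proof. exact: sigma_min_gram_le. Qed.

Definition feature_sqnorm (x : 'M[R]_(n, q)) : R :=
  \sum_j feature_dot M (feature_comb M x j) (feature_comb M x j).

Lemma feature_sqnorm_ge0 x : 0 <= feature_sqnorm x.
Proof. by apply: sumr_ge0 => j _; exact: dot_ge0. Qed.

(** Each entry of [K x] is an inner product of some [phi i] with a column of [Phi x]: Cauchy-Schwarz
    in feature space passes from the norm inside [f] to matrices. *)
Lemma kernel_mul_sqnorm_le x : frob_dot (K *m x) (K *m x)
  <= (\sum_i feature_dot M (phi M i) (phi M i)) * feature_sqnorm x.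
Proof.
rewrite /frob_dot mulr_suml; apply: ler_sum => i _.
rewrite mulr_sumr; apply: ler_sum => j _.
have -> : (K *m x) i j = feature_dot M (phi M i) (feature_comb M x j).
  rewrite mxE linear_sum; apply: eq_bigr => k _.
  by rewrite linearZ/= mxE mulrC.
by rewrite -expr2 dot_CS.
Qed.

Lemma feature_sqnormZ c x : feature_sqnorm (c *: x) = c ^+ 2 * feature_sqnorm x.
Proof.
rewrite /feature_sqnorm mulr_sumr; apply: eq_bigr => j _.
have -> : feature_comb M (c *: x) j = c *: feature_comb M x j.
  rewrite /feature_comb scaler_sumr; apply: eq_bigr => i _.
  by rewrite mxE scalerA.
by rewrite linearZ/= dotC linearZ/= mulrA -expr2.
Qed.

(* Along a ray [h] is convex with [h 0 < h 1], hence grows at least linearly. *)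
Lemma regularizer_coercive : convex f ->
  forall C, exists D, forall x, f x <= C -> frob_dot (K *m x) (K *m x) <= D.
Proof.
move=> cf C; set P := \sum_i feature_dot M (phi M i) (phi M i).
have P0 : 0 <= P by apply: sumr_ge0 => i _; exact: dot_ge0.
have h01 : h M 0 < h M 1 by apply: h_incr; rewrite ?in_itv/= ?lexx ?ler01 ?ltr01.
(* Bound on the feature norm [s]: when [s > 1], [f x >= h 0 + s (h 1 - h 0)]; the summand 1 covers
   [s <= 1]. *)
pose r := 1 + `|(C - h M 0) / (h M 1 - h M 0)|.
have r1 : 1 <= r by rewrite lerDl.
exists (P * r ^+ 2) => x fx.
apply: le_trans (kernel_mul_sqnorm_le x) _; apply: ler_wpM2l => //.
pose s := Num.sqrt (feature_sqnorm x).
rewrite -[leLHS]sqr_sqrtr ?feature_sqnorm_ge0// -/s.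
rewrite ler_sqr ?nnegrE ?sqrtr_ge0//; last exact: le_trans ler01 r1.
have [s1|s1] := leP s 1; first exact: le_trans s1 r1.
have s0 : 0 < s by exact: lt_trans s1.
apply: le_trans (_ : (C - h M 0) / (h M 1 - h M 0) <= _); last first.
  by apply: le_trans (ler_norm _) _; rewrite lerDr.
rewrite ler_pdivlMr ?subr_gt0//.
have s01 : 0 <= s^-1 <= 1 by rewrite invr_ge0 ltW//= invf_le1// ltW.
(* The point [x / s] has feature norm 1. *)
have := convex_ineq x 0 cf s01.
have -> : f 0 = h M 0.
  rewrite /regularizer -/(feature_sqnorm 0) -(scale0r 0) feature_sqnormZ expr0n.
  by rewrite mul0r sqrtr0.
have -> : f (s^-1 *: x + (1 - s^-1) *: 0) = h M 1.
  rewrite scaler0 addr0 /regularizer -/(feature_sqnorm _) feature_sqnormZ.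
  rewrite -[X in _ * X]sqr_sqrtr ?feature_sqnorm_ge0// -/s -exprMn mulVf ?gt_eqF//.
  by rewrite expr1n sqrtr1.
rewrite -(ler_pM2l s0) mulrDr !mulrA mulrBr mulfV ?gt_eqF// mulr1 mul1r.
by move=> H; lra.
Qed.

(** [fine] sends an infinite total to 0, so the value is faithful at feasible labelings. *)
Definition total_energy (y : {ffun 'I_n -> 'I_q}) : R :=
  fine (\sum_(C in edges M) energy M C y).

Lemma lagrangian_feasible rho a b l y : feasible M y ->
  lagrangian M rho a b l y
  = (real_lagrangian K rho f (loss M) total_energy a b l y)%:E.
Proof.
move=> yM; rewrite /lagrangian /real_lagrangian sqr_frob !EFinD /total_energy.
rewrite fineK//; apply/sum_fin_numP => C _ CM.
by rewrite fin_numElt energy_gtNy//= yM.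
Qed.

Lemma lagrangian_infeasible rho a b l y : ~ feasible M y ->
  lagrangian M rho a b l y = +oo%E.
Proof.
move=> yM; rewrite /lagrangian; set S := (\sum_(C in _) _)%E.
have -> : S = +oo%E.
  apply/esum_eqyP => [C CM|]; first by rewrite gt_eqF// energy_gtNy.
  apply: contrapT => H; apply: yM => C CM; rewrite ltey; apply/negP => /eqP EC.
  by apply: H; exists C; rewrite mem_index_enum.
by rewrite addey// addye.
Qed.

End model_theory.

(** * Runs: feasibility and optimality of the individual steps *)

Section run_theory.
Context {R : realType} {n q : nat} {M : dc_model R n q}.
Context {L m delta tau rho_max : R} {alpha beta lam : nat -> 'M[R]_(n, q)}.
Context {y yhat : nat -> {ffun 'I_n -> 'I_q}}.
Context {B : nat -> 'I_n -> 'I_q -> 'rV[R]_q} {u : nat -> 'I_n -> 'I_q -> R}.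
Context {rho_ : nat -> R}.
Hypothesis run : dc_admm M L m delta tau rho_max alpha beta lam y yhat B u rho_.
Hypothesis delta_gt0 : 0 < delta.
Local Notation K := (kernel M).
Local Notation f := (regularizer M).
Local Notation rlag rho := (real_lagrangian K rho f (loss M) (total_energy M)).

Lemma penalty_gt0 t : 0 < rho_ t.
Proof.
elim: t => [|t IH]; first exact: dc_rho0 run.
rewrite (dc_rho run); case: ifP => // _.
by rewrite lt_min (proj1 (dc_rho_max run)) mulr_gt0// (lt_trans ltr01 (dc_tau run)).
Qed.

(** If [y t] is infeasible, the tested difference is finite minus +oo, that is -oo, and the
    candidate is accepted. *)
Lemma accept_feasible t : feasible M (yhat t.+1) -> feasible M (y t.+1).
Proof.
move=> fh; rewrite (dc_label run); case: ifP => // /negP h.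
apply: contrapT => fy; apply: h.
by rewrite (lagrangian_feasible _ _ _ _ fh) (lagrangian_infeasible _ _ _ _ fy) leNye.
Qed.

(** An infeasible candidate makes the tested difference +oo, so it is rejected. *)
Lemma feasible_step t : feasible M (y t) -> feasible M (y t.+1).
Proof.
move=> fy; rewrite (dc_label run); case: ifP => // h.
apply: contrapT => fh; move: h.
by rewrite (lagrangian_feasible _ _ _ _ fy) (lagrangian_infeasible _ _ _ _ fh).
Qed.

Lemma feasible_from t0 t : feasible M (y t0) -> (t0 <= t)%N -> feasible M (y t).
Proof. by move=> f0 /subnK <-; elim: (t - t0)%N => // k; exact: feasible_step. Qed.

Lemma beta_row t i : row i (beta t.+1) = B t.+1 i (y t.+1 i).
Proof. by rewrite (dc_beta run); apply/rowP => j; rewrite !mxE. Qed.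

(** Matches the subgradient produced by [prox_subgradient] with a multiplier-like matrix. *)
Lemma row_multiplier (rho : R) (a l b : 'M[R]_(n, q)) i : 0 < rho ->
  rho *: (row i K *m a + rho^-1 *: row i l - row i b)
  = row i (l + rho *: (K *m a - b)).
Proof.
move=> r0; rewrite -row_mul; apply/rowP => j; rewrite !mxE.
by rewrite mulrBr mulrDr mulVKf ?gt_eqF//; ring.
Qed.

Lemma beta_subgradient t i b : convex (loss M (y t.+1 i)) ->
  loss M (y t.+1 i) (row i (beta t.+1))
  + frob_dot (row i (lam t + rho_ t *: (K *m alpha t - beta t.+1)))
      (b - row i (beta t.+1))
  <= loss M (y t.+1 i) b.
Proof.
move=> cl; rewrite -row_multiplier ?penalty_gt0//.
apply: (@prox_subgradient _ _ _ _ (rho_ t)) => // z.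
have [+ _] := dc_unary run t i (y t.+1 i) => /(_ z).
by rewrite /unary_objective !opprD !addrA beta_row.
Qed.

(* Completing the square: the per-vertex objectives of step 1 differ from the
   terms of the Lagrangian by [frob (row i lam) ^+ 2 / (2 * rho)] only. *)
Lemma unary_objective_lagrangian (rho : R) (a l b : 'M[R]_(n, q)) z : 0 < rho ->
  rlag rho a b l z = \sum_i unary_objective M rho a l i (z i) (row i b)
    + (f a + total_energy M z - rho^-1 / 2 * frob_dot l l).
Proof.
move=> r0; rewrite /unary_objective big_split/= -mulr_sumr.
have -> : \sum_i frob (row i b - row i K *m a - rho^-1 *: row i l) ^+ 2 =
    frob_dot (b - K *m a - rho^-1 *: l) (b - K *m a - rho^-1 *: l).
  rewrite frob_dot_rows; apply: eq_bigr => i _.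
  by rewrite sqr_frob -row_mul; congr frob_dot; apply/rowP => j; rewrite !mxE.
rewrite /real_lagrangian -(opprB _ b); move: (K *m a - b) => d.
rewrite !frob_dot_linE (frob_dotC d l).
have := mulfV (lt0r_neq0 r0); move: (rho^-1) => k rk.
set x := rho / 2 * (_ + _).
have -> : x = rho / 2 * frob_dot d d + (rho * k) * frob_dot l d
    + (rho * k) * (k / 2 * frob_dot l l) by rewrite /x; field.
by rewrite rk; ring.
Qed.

Lemma label_descent t : feasible M (y t) ->
  rlag (rho_ t) (alpha t) (beta t.+1) (lam t) (y t.+1)
  <= rlag (rho_ t) (alpha t) (beta t) (lam t) (y t)
     - (y t.+1 != y t)%:R * delta.
Proof.
move=> fy.
(* Minimality of the rows of [B] handles the unchanged labeling; the acceptance test then pays for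
   [delta]. *)
have keep : rlag (rho_ t) (alpha t) (select_rows (B t.+1) (y t)) (lam t) (y t)
    <= rlag (rho_ t) (alpha t) (beta t) (lam t) (y t).
  rewrite !unary_objective_lagrangian ?penalty_gt0// lerD2r.
  apply: ler_sum => i _; have [+ _] := dc_unary run t i (y t i).
  move=> /(_ (row i (beta t))).
  have -> // : row i (select_rows (B t.+1) (y t)) = B t.+1 i (y t i).
  by apply/rowP => j; rewrite !mxE.
have := feasible_step fy; rewrite (dc_beta run) (dc_label run).
case: ifP => [+ fh|_ _]; last by rewrite eqxx mul0r subr0.
rewrite !lagrangian_feasible// -EFinB lee_fin => h.
rewrite lerBlDl in h; apply: le_trans h _; rewrite lerB//.
by case: eqP => _ /=; rewrite ?mul0r ?mul1r// ltW.
Qed.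

Lemma multiplier_stationary t : feasible M (y t.+1) ->
  differentiable f (alpha t.+1) ->
  K *m lam t.+1 = - gradient f (alpha t.+1).
Proof.
move=> fy df; apply/eqP; rewrite -eqr_oppLR eq_sym; apply/eqP.
apply: gradient_stationary => // v.
(* The second-order term of the penalty along [v]; its first-order term completes [lam t] to
   [lam t.+1]. *)
exists (rho_ t / 2 * frob_dot (K *m v) (K *m v)) => s _.
have := dc_alpha run t (alpha t.+1 + s *: v).
rewrite !lagrangian_feasible// lee_fin /real_lagrangian.
have -> : frob_dot (K *m lam t.+1) v = frob_dot (lam t.+1) (K *m v).
  by rewrite frob_dot_mulmx kernel_sym.
rewrite mulmxDr -scalemxAr [_ + _ - beta _]addrAC (dc_lam run).
move: (K *m alpha t.+1 - beta t.+1) (K *m v) => r w.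
by rewrite !frob_dot_linE (frob_dotC w r) => h; lra.
Qed.

End run_theory.

(** * From the saddle point to a critical point and a global minimizer *)

Lemma subgradient_subdiff (R : realType) (p q : nat) (g : 'M[R]_(p, q) -> R)
    (x v : 'M[R]_(p, q)) :
  (forall z, g x + frob_dot v (z - x) <= g z) -> subdiff g x v.
Proof.
(* Constant sequences do: a global subgradient is regular, the error term only weakening the
   inequality. *)
move=> sub; exists (fun=> x), (fun=> v); split; do ?exact: cvg_cst.
move=> _ e e0; apply: (@filterE _ (nbhs x) (nbhs_filter x)) => z; apply: le_trans (sub z).
by rewrite gerBl mulr_ge0 ?frob_ge0 ?ltW.
Qed.

(** With [x = rho * sigma M], multiplying the condition by [x] gives [2 L^2 + m x < x^2]. *)
Lemma penalty_ok_large (R : realType) (n q : nat) (M : dc_model R n q)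
    (L m rho : R) : 0 < m -> 0 < rho -> 0 < sigma M ->
  penalty_ok M L m rho -> 2 * L ^+ 2 < (rho * sigma M) ^+ 2.
Proof.
move=> m0 r0 s0; rewrite /penalty_ok; have rs : 0 < rho * sigma M by rewrite mulr_gt0.
move: (rho * sigma M) rs => x x0; rewrite -(pmulr_rlt0 _ x0) mulrDr mulrCA.
rewrite mulfV ?gt_eqF// mulr1 => h.
have xm : 0 < x * m by rewrite mulr_gt0.
by lra.
Qed.

Lemma cvg_shiftnS (R : realType) (p q : nat) (T : nat) (a : nat -> 'M[R]_(p, q))
    (l : 'M[R]_(p, q)) : (fun t => a (t + T).+1) @ \oo --> l -> a @ \oo --> l.
Proof. by move=> h; rewrite -(cvg_shiftn T.+1 a); under eq_fun do rewrite addnS. Qed.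

(** Add the subgradient inequalities of the losses and of [f]: the linear terms [<l, K (x - a)>] and
    [<g, x - a>] cancel. *)
Lemma saddle_global_min (R : realType) (n q : nat) (M : dc_model R n q)
    (a l : 'M[R]_(n, q)) (ys : {ffun 'I_n -> 'I_q}) (g : 'M[R]_(n, q)) :
  kernel M *m l = - g ->
  (forall x, regularizer M a + frob_dot g (x - a) <= regularizer M x) ->
  (forall i b, loss M (ys i) (row i (kernel M *m a))
     + frob_dot (row i l) (b - row i (kernel M *m a)) <= loss M (ys i) b) ->
  forall x, \sum_i loss M (ys i) (row i (kernel M) *m a) + regularizer M a
    <= \sum_i loss M (ys i) (row i (kernel M) *m x) + regularizer M x.
Proof.
move=> Kl subf sub x.
have sumE z : \sum_i loss M (ys i) (row i (kernel M) *m z) =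
    \sum_i loss M (ys i) (row i (kernel M *m z)).
  by apply: eq_bigr => i _; rewrite row_mul.
have : \sum_i loss M (ys i) (row i (kernel M *m a))
    + frob_dot l (kernel M *m x - kernel M *m a)
    <= \sum_i loss M (ys i) (row i (kernel M *m x)).
  rewrite frob_dot_rows -big_split/=; apply: ler_sum => i _.
  by rewrite linearB/=; exact: sub.
rewrite -mulmxBr frob_dot_mulmx kernel_sym Kl frob_dotNl; have := subf x.
by rewrite !sumE => h1 h2; lra.
Qed.

(** [finite_energy] excludes runs that only ever see infeasible labelings, whose limit labeling
    could not be feasible. *)
Theorem proposition2 (R : realType) (n q : nat) (M : dc_model R n q)
    (L m delta tau rho_max rho : R) (T0 : nat)
    (alpha beta lam : nat -> 'M[R]_(n, q))
    (y yhat : nat -> {ffun 'I_n -> 'I_q})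
    (B : nat -> 'I_n -> 'I_q -> 'rV[R]_q)
    (u : nat -> 'I_n -> 'I_q -> R) (rho_ : nat -> R)
    (* (A1) *)
    (f_lb : lower_bounded (regularizer M))
    (f_smooth : smooth L (regularizer M))
    (m_gt0 : 0 < m)
    (f_semiconvex : semiconvex m (regularizer M))
    (* (A2) *)
    (loss_lb : forall k, lower_bounded (loss M k))
    (* (A3) *)
    (K_surj : 0 < sigma M)
    (* (A4) *)
    (T0_ge1 : (1 <= T0)%N)
    (rho_fixed : forall t, (T0 <= t)%N -> rho_ t = rho)
    (rho_ok : penalty_ok M L m rho)
    (f_convex : proper_convex_lsc (regularizer M))
    (loss_convex : forall k, proper_convex_lsc (loss M k))
    (delta_gt0 : 0 < delta)
    (run : dc_admm M L m delta tau rho_max alpha beta lam y yhat B u rho_)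
    (* a labeling of finite energy is available at the start or is proposed
       at some iteration *)
    (finite_energy : feasible M (y 0%N) \/ exists t, feasible M (yhat t.+1)) :
  exists (alphas betas lams : 'M[R]_(n, q)) (ys : {ffun 'I_n -> 'I_q}),
    [/\ [/\ alpha @ \oo --> alphas, beta @ \oo --> betas, lam @ \oo --> lams
          & \forall t \near \oo, y t = ys],
        dc_critical M alphas betas lams ys
      & forall a : 'M[R]_(n, q),
          \sum_i loss M (ys i) (row i (kernel M) *m alphas)
            + regularizer M alphas
          <= \sum_i loss M (ys i) (row i (kernel M) *m a) + regularizer M a].
Proof.
have [Tf yTf] : exists Tf, feasible M (y Tf).
  case: finite_energy => [y0|[t yt]]; first by exists 0%N.
  by exists t.+1; exact: accept_feasible run _ yt.
(* From [T] on, the penalty is [rho] and the labeling is feasible. *)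
pose T := maxn T0 Tf.
have rhoT t : rho_ (t + T)%N = rho.
  by apply: rho_fixed; rewrite (leq_trans (leq_maxl T0 Tf))// leq_addl.
have rhoTS t : rho_ (t + T).+1 = rho by exact: (rhoT t.+1).
have yT t : feasible M (y (t + T)%N).
  by apply: (feasible_from run yTf); rewrite (leq_trans (leq_maxr T0 Tf))// leq_addl.
have rho_gt0 : 0 < rho by rewrite -(rhoT 0%N) (penalty_gt0 run).
have [f_diff f_lip] := f_smooth; have [_ f_conv _] := f_convex.
have f_grad x z : regularizer M x + frob_dot (gradient (regularizer M) x) (z - x)
    <= regularizer M z by exact: convex_gradient_le.
have stat t : kernel M *m lam (t + T).+1
    = - gradient (regularizer M) (alpha (t + T).+1).
  by apply: (multiplier_stationary run) => //; exact: (yT t.+1).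
(* The shift by [T + 1] makes index 0 already the outcome of an alpha-step with a feasible labeling,
   so stationarity holds from the start. *)
have [|t|t i b|t|a [l [ys [[a_cvg b_cvg l_cvg y_cvg] Kl sub]]]] := @admm_cvg R n q
    (kernel M) (sigma M) rho L delta (kernel_sym M) K_surj
    (@sigma_kernel_le _ _ _ M) rho_gt0 delta_gt0
    (penalty_ok_large m_gt0 rho_gt0 K_surj rho_ok)
    (regularizer M) (gradient (regularizer M)) f_lb f_grad f_lip
    (regularizer_coercive f_conv) (loss M) loss_lb
    (fun k => let: And3 _ _ lsc := loss_convex k in lsc) (total_energy M)
    (fun t => alpha (t + T).+1) (fun t => beta (t + T).+1)
    (fun t => lam (t + T).+1) (fun t => y (t + T).+1).
- exact: stat.
- by rewrite -(rhoTS t); exact: (dc_lam run).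
- have [_ cl _] := loss_convex (y (t.+1 + T).+1 i).
  by rewrite -(rhoTS t); exact: (beta_subgradient run).
- by rewrite -(rhoTS t); apply: (label_descent run) => //; exact: (yT t.+1).
have ev : \forall t \near \oo, y t = ys.
  case: y_cvg => N _ yN; exists (N + T.+1)%N => // t /= Nt.
  have Tt : (T.+1 <= t)%N by apply: leq_trans Nt; exact: leq_addl.
  have := yN (t - T.+1)%N; rewrite /= -addnS subnK//; apply.
  by rewrite leq_subRL// addnC.
exists a, (kernel M *m a), l, ys; split.
- by split=> //; apply: (@cvg_shiftnS _ _ _ T).
- split=> //.
  + move=> i; exists (row i l); last by rewrite subrr.
    by apply: subgradient_subdiff => b; exact: sub.
  + exists (gradient (regularizer M) a); last by rewrite kernel_sym Kl subrr.
    by apply: subgradient_subdiff => z; exact: f_grad.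
  (* The limit labeling is attained at some iteration past [Tf], hence feasible. *)
  + have [t [tT ty]] : exists t, (Tf <= t)%N /\ y t = ys.
      near \oo => t; exists t; split; near: t => //.
      exact: nbhs_infty_ge.
    by rewrite -ty; exact: (feasible_from run yTf).
- exact: saddle_global_min Kl (f_grad a) sub.
Unshelve. all: by end_near. Qed.
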